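(* The following are equivalent: (1) The sets $\mathrm{Fix}_k(\sigma)^\circ$ are closed in $X$ for all $k\in\mathbb{Z}$. (2) There exists a (not necessarily continuous) projection $E'$ from $\ell^1(\Sigma)$ onto $C(X)'_1$ which is positive in the sense that $\phi(E'(\ell))\ge0$ for all $\ell\in\ell^1(\Sigma)_+$ and all states $\phi$ of $C(X)'_1$. In that case a projection as in (2) is unique. Denoting it by $E'$ and denoting by $\chi_k$ the (continuous) characteristic function of $\mathrm{Fix}_k(\sigma)^\circ$, it is given by $E'\big(\sum_kf_k\delta^k\big)=\sum_k\chi_kf_k\delta^k$ for $\sum_kf_k\delta^k\in\ell^1(\Sigma)$. Furthermore, $E'$ is a faithful involutive norm one projection, is a morphism of $C(X)'_1$-bimodules, and restricts to a projection from $c_{00}(\Sigma)$ onto $C(X)'_{00}$.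
   Context: Let $X$ be a non-empty compact Hausdorff space and $\sigma:X\to X$ a homeomorphism; $\mathrm{Fix}_k(\sigma)=\{x:\sigma^kx=x\}$ and superscript $\circ$ denotes interior. $C(X)$ is the algebra of continuous complex functions with sup norm, $\alpha(f)=f\circ\sigma^{-1}$. $\ell^1(\Sigma)$ is the set of $\ell:\mathbb{Z}\to C(X)$ with $\|\ell\|=\sum_k\|\ell(k)\|_\infty<\infty$, product $(\ell\ell')(n)=\sum_k\ell(k)\alpha^k(\ell'(n-k))$, involution $\ell^*(n)=\overline{\alpha^n(\ell(-n))}$; it is a unital Banach $*$-algebra. With $\delta$ the element equal to the constant $1$ at $1\in\mathbb{Z}$ and $0$ elsewhere, elements are written $\sum_kf_k\delta^k$ ($f_k=\ell(k)$), and $C(X)$ is embedded as $\{f\delta^0\}$. $c_{00}(\Sigma)$ is the $*$-subalgebra of finite sums. $C(X)'_1$ and $C(X)'_{00}$ are the commutants of $C(X)$ in $\ell^1(\Sigma)$ and in $c_{00}(\Sigma)$. The positive cone $\ell^1(\Sigma)_+$ is the set of all finite sums $\sum_j\ell_j^*\ell_j$, $\ell_j\in\ell^1(\Sigma)$; a linear map on $\ell^1(\Sigma)$ is faithful if $0$ is the only element of $\ell^1(\Sigma)_+$ in its kernel. A state of $C(X)'_1$ is a linear functional $\phi$ with $\phi(a^*a)\ge0$ and $\phi(1)=1$. A projection onto $C(X)'_1$ is a linear idempotent map with range $C(X)'_1$; involutive means $E'(\ell^* )=E'(\ell)^*$. *)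

(* Defs.v *)
From mathcomp Require Import all_boot all_order all_algebra.
From mathcomp Require Import all_classical all_reals all_analysis.
From mathcomp Require Import complex.
Set Implicit Arguments. Unset Strict Implicit. Unset Printing Implicit Defensive.
Import Order.TTheory GRing.Theory Num.Theory.
Import numFieldTopology.Exports numFieldNormedType.Exports.
Local Open Scope classical_set_scope.
Local Open Scope ring_scope.
Local Open Scope complex_scope.

Section L1Sigma.
Variables (R : realType) (X : topologicalType).
(* sigma is the homeomorphism, sigmai its inverse *)
Variables (sigma sigmai : X -> X).

Definition cabs (z : R[i]) : R := ComplexField.Normc.normc z.

Definition ccont (f : X -> R[i]) : Prop :=
  continuous ((fun x => complex.Re (f x)) : X -> R) /\ continuous ((fun x => complex.Im (f x)) : X -> R).

Definition supnorm (f : X -> R[i]) : R := sup [set cabs (f x) | x in [set: X]].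

Definition iterz (k : int) : X -> X :=
  match k with Posz n => iter n sigma | Negz n => iter n.+1 sigmai end.

Definition Fixk (k : int) : set X := [set x | iterz k x = x].

Definition chi (k : int) (x : X) : R[i] := (`[< interior (Fixk k) x >])%:R.

(* formal series sum_k f_k delta^k : maps int -> C(X) *)
Definition ser := int -> X -> R[i].

Definition ser0 : ser := fun _ _ => 0.
Definition seradd (a b : ser) : ser := fun k x => a k x + b k x.
Definition serscale (c : R[i]) (a : ser) : ser := fun k x => c * a k x.

(* symmetric partial sums over Z: sum_{-N <= k < N} *)
Definition zpartial (u : int -> R) (N : nat) : R :=
  (\sum_(i < N) (u (i%:Z) + u (- (i.+1)%:Z)))%R.

(* sum over Z of a complex family (used only for absolutely summable ones) *)
Definition zsumC (u : int -> R[i]) : R[i] :=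
  Complex (limn (zpartial (fun k => complex.Re (u k)))) (limn (zpartial (fun k => complex.Im (u k)))).

Definition in_l1 (l : ser) : Prop :=
  (forall k, ccont (l k)) /\ cvgn (zpartial (fun k => supnorm (l k))).

Definition l1norm (l : ser) : R := limn (zpartial (fun k => supnorm (l k))).

(* alpha^k(f) = f o sigma^{-k} ; product (l l')(n) = sum_k l(k) alpha^k(l'(n-k)) *)
Definition sermul (l l' : ser) : ser :=
  fun n x => zsumC (fun k => l k x * l' (n - k) (iterz (- k) x)).

(* involution l^*(n) = conj(alpha^n(l(-n))) *)
Definition serstar (l : ser) : ser := fun n x => (l (- n) (iterz (- n) x))^*.

Definition emb (f : X -> R[i]) : ser := fun n x => if n == 0 then f x else 0.
Definition ser1 : ser := emb (fun _ => 1).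

Definition in_c00 (l : ser) : Prop :=
  in_l1 l /\ exists N : nat, forall k : int, (N <= `|k|)%N -> l k = (fun _ => 0).

Definition comm1 (l : ser) : Prop :=
  in_l1 l /\ forall f, ccont f -> sermul (emb f) l = sermul l (emb f).
Definition comm00 (l : ser) : Prop :=
  in_c00 l /\ forall f, ccont f -> sermul (emb f) l = sermul l (emb f).

Definition poscone (l : ser) : Prop :=
  exists s : seq ser, (forall a, a \in s -> in_l1 a) /\
    l = foldr (fun a acc => seradd (sermul (serstar a) a) acc) ser0 s.

Definition is_state (phi : ser -> R[i]) : Prop :=
  (forall a b (c d : R[i]), comm1 a -> comm1 b ->
     phi (seradd (serscale c a) (serscale d b)) = c * phi a + d * phi b) /\
  (forall a, comm1 a -> 0 <= phi (sermul (serstar a) a)) /\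
  phi ser1 = 1.

Definition is_proj (E : ser -> ser) : Prop :=
  (forall l, in_l1 l -> in_l1 (E l)) /\
  (forall a b (c d : R[i]), in_l1 a -> in_l1 b ->
     E (seradd (serscale c a) (serscale d b)) = seradd (serscale c (E a)) (serscale d (E b))) /\
  (forall l, in_l1 l -> E (E l) = E l) /\
  (forall l, in_l1 l -> comm1 (E l)) /\
  (forall l, comm1 l -> exists l', in_l1 l' /\ E l' = l).

Definition is_positive (E : ser -> ser) : Prop :=
  forall l phi, poscone l -> is_state phi -> 0 <= phi (E l).

Definition is_faithful (E : ser -> ser) : Prop :=
  forall l, poscone l -> E l = ser0 -> l = ser0.

Definition is_involutive (E : ser -> ser) : Prop :=
  forall l, in_l1 l -> E (serstar l) = serstar (E l).

Definition opnorm_set (E : ser -> ser) : set R :=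
  [set l1norm (E l) | l in [set l | in_l1 l /\ l1norm l <= 1]].
Definition is_norm_one (E : ser -> ser) : Prop :=
  has_sup (opnorm_set E) /\ sup (opnorm_set E) = 1.

Definition is_bimodule_morphism (E : ser -> ser) : Prop :=
  forall a l b, comm1 a -> in_l1 l -> comm1 b ->
    E (sermul a l) = sermul a (E l) /\ E (sermul l b) = sermul (E l) b.

Definition restricts_c00 (E : ser -> ser) : Prop :=
  (forall l, in_c00 l -> comm00 (E l)) /\
  (forall l, comm00 l -> exists l', in_c00 l' /\ E l' = l).

End L1Sigma.

(* Main.v *)
(** The commutant [A] of [C(X)] in [l^1] consists of the series whose [k]-th
    coefficient lives in the interior of [Fix_k], so that the only candidate for
    the projection is multiplication of the [k]-th coefficient by [chi_k].

    For [|c| = 1] and [m <> 0], the functionals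
    [l |-> l_0(x) + (c l_m(x) + conj(c) l_{-m}(x)) / 2] are states of [A] which
    separate points and restrict to evaluation at [x] on [C(X)].  Composing such a
    state with a positive projection [E] and applying Cauchy-Schwarz to [g - g(x)]
    shows that [E] is a [C(X)]-bimodule map.  Hence [E(f delta^k)] is killed by
    [g - g o sigma^{-k}] for every [g], i.e. it vanishes off the interior of [Fix_k]:
    then [E(delta^k)_k] is the characteristic function of that interior, which is
    therefore closed, and [E(f delta^k) = chi_k f delta^k].  In [l^1], and in [A],
    [1 - h] is a square for every small hermitian [h], so positive functionals are
    automatically bounded and the formula extends from finite sums to all series.

    Conversely, for a finite sum [p] with exponents in [s], call [i, j] in [s]
    equivalent at [x] when [x] is in the interior of [Fix_{i-j}].  Averaging over the
    equivalence classes writes the image of [p^* p] as a finite sum of squares of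
    elements of [A]; general series follow by truncation and boundedness of states. *)

Require Import Defs.
From mathcomp Require Import all_boot all_order all_algebra.
From mathcomp Require Import all_classical all_reals all_analysis.
From mathcomp Require Import complex.
From mathcomp Require Import ring lra zify.
Set Implicit Arguments. Unset Strict Implicit. Unset Printing Implicit Defensive.
Import Order.TTheory GRing.Theory Num.Theory.
Import numFieldTopology.Exports numFieldNormedType.Exports.
Local Open Scope classical_set_scope.
Local Open Scope ring_scope.
Local Open Scope complex_scope.

(** * Real-valued modulus on the complex numbers *)

Section ComplexAbs.
Variable R : realType.
Implicit Types z w : R[i].

Lemma normE_cabs z : `|z| = (cabs z)%:C.
Proof. by case: z. Qed.

Lemma cabs_ge0 z : 0 <= cabs z.
Proof. by rewrite -lecR -normE_cabs normr_ge0. Qed.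

Lemma cabs0 : cabs (0 : R[i]) = 0.
Proof. exact: ComplexField.Normc.normc0. Qed.

Lemma cabs1 : cabs (1 : R[i]) = 1.
Proof. exact: ComplexField.Normc.normc1. Qed.

Lemma cabsM z w : cabs (z * w) = cabs z * cabs w.
Proof. exact: ComplexField.Normc.normcM. Qed.

Lemma cabsN z : cabs (- z) = cabs z.
Proof. exact: normcN. Qed.

Lemma cabsD z w : cabs (z + w) <= cabs z + cabs w.
Proof. exact: le_normcD. Qed.

Lemma cabsB z w : cabs (z - w) <= cabs z + cabs w.
Proof. by rewrite -(cabsN w) cabsD. Qed.

Lemma cabs_subC z w : cabs (z - w) = cabs (w - z).
Proof. by rewrite -cabsN opprB. Qed.

Lemma cabs_tri v z w : cabs (z - w) <= cabs (z - v) + cabs (v - w).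
Proof. by apply: le_trans (cabsD _ _); rewrite addrA subrK. Qed.

Lemma cabsJ z : cabs z^* = cabs z.
Proof. by case: z => a b; rewrite /cabs /= sqrrN. Qed.

Lemma cabs_real (a : R) : 0 <= a -> cabs a%:C = a.
Proof. by move=> a0; rewrite /cabs /= expr0n /= addr0 sqrtr_sqr ger0_norm. Qed.

Lemma cabs_eq0 z : cabs z = 0 -> z = 0.
Proof. exact: ComplexField.Normc.eq0_normc. Qed.

Lemma cabs_Re z : `|complex.Re z| <= cabs z.
Proof. by rewrite -lecR -normE_cabs normc_ge_Re. Qed.

Lemma cabs_Im z : `|complex.Im z| <= cabs z.
Proof.
by case: z => a b; rewrite /cabs /= -sqrtr_sqr ler_wsqrtr // lerDr sqr_ge0.
Qed.

Lemma cabs_le_ReIm z : cabs z <= `|complex.Re z| + `|complex.Im z|.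
Proof.
case: z => a b; have {1}-> : a +i* b = a +i* 0 + 0 +i* b by simpc.
apply: le_trans (cabsD _ _) _.
by rewrite /cabs /= !expr0n /= addr0 add0r !sqrtr_sqr.
Qed.

Lemma cabs_sum (I : Type) (s : seq I) (u : I -> R[i]) :
  cabs (\sum_(k <- s) u k) <= \sum_(k <- s) cabs (u k).
Proof.
elim: s => [|k s IH]; first by rewrite !big_nil cabs0.
by rewrite !big_cons (le_trans (cabsD _ _)) // lerD2l.
Qed.

Lemma cabs_small z : (forall e : R, 0 < e -> cabs z <= e) -> z = 0.
Proof.
move=> h; apply: cabs_eq0; apply/eqP; rewrite eq_le cabs_ge0 andbT.
by apply/ler_addgt0Pr => e e0; rewrite add0r h.
Qed.

Lemma Re_sum (I : Type) (s : seq I) (u : I -> R[i]) :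
  complex.Re (\sum_(k <- s) u k) = \sum_(k <- s) complex.Re (u k).
Proof. by elim/big_rec2: _ => // k x [a b] _ <-; case: (u k). Qed.

Lemma Im_sum (I : Type) (s : seq I) (u : I -> R[i]) :
  complex.Im (\sum_(k <- s) u k) = \sum_(k <- s) complex.Im (u k).
Proof. by elim/big_rec2: _ => // k x [a b] _ <-; case: (u k). Qed.

Lemma conjcE z : z * z^*%C = (cabs z ^+ 2)%:C.
Proof. by rewrite -sqr_normc normE_cabs -rmorphXn. Qed.

Lemma conjc_sum (I : Type) (s : seq I) (u : I -> R[i]) :
  (\sum_(k <- s) u k)^* = \sum_(k <- s) (u k)^*.
Proof. exact: rmorph_sum. Qed.

Lemma complex_ge0 z : (0 <= z) = (complex.Im z == 0) && (0 <= complex.Re z).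
Proof. by case: z. Qed.

(** Nonnegativity in [R[i]] means zero imaginary part and nonnegative real part, both closed
    conditions. It carries positivity of states from truncations to arbitrary series. *)
Lemma complex_ge0_closed z :
  (forall e : R, 0 < e -> exists2 w, 0 <= w & cabs (z - w) <= e) -> 0 <= z.
Proof.
move=> h; rewrite complex_ge0; apply/andP; split.
  apply/eqP; have := @cabs_small (complex.Im z)%:C.
  move=> hI; suff [//] : (complex.Im z)%:C = 0 :> R[i].
  apply: hI => e /h[w]; rewrite complex_ge0 => /andP[/eqP w0 _].
  apply: le_trans; apply: le_trans (cabs_Im _).
  by case: z w w0 {h} => a b [c d] /= ->; rewrite /cabs /= expr0n /= addr0 sqrtr_sqr subr0.
apply/ler_addgt0Pr => e /h[w]; rewrite complex_ge0 => /andP[_ w0].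
move=> /(le_trans (cabs_Re _)); case: z w w0 {h} => a b [c d] /= c0.
by rewrite ler_norml => /andP[]; lra.
Qed.

End ComplexAbs.

(** * Unordered absolutely convergent sums over the integers *)

Section UnorderedSums.
Variable R : realType.
Implicit Types (u v : int -> R[i]) (s t : seq int).

Lemma sum_split_subset (V : zmodType) (u : int -> V) s t :
  uniq s -> uniq t -> {subset t <= s} ->
  \sum_(k <- s) u k = \sum_(k <- t) u k + \sum_(k <- [seq k <- s | k \notin t]) u k.
Proof.
move=> us ut ts; rewrite -big_cat; apply: perm_big; apply: uniq_perm => //.
  rewrite cat_uniq ut filter_uniq // andbT; apply/hasPn => k.
  by rewrite mem_filter => /andP[].
move=> k; rewrite mem_cat mem_filter.
by case: (boolP (k \in t)) => //= /ts ->.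
Qed.

(** The range [-N <= k < N] of [zpartial] as a list, [Negz n] being [-(n+1)]. *)
Fixpoint zseq (N : nat) : seq int :=
  if N is n.+1 then Posz n :: Negz n :: zseq n else [::].

Lemma zpartialE (u : int -> R) N : zpartial u N = \sum_(k <- zseq N) u k.
Proof.
elim: N => [|N IH]; first by rewrite /zpartial big_ord0 big_nil.
rewrite /zpartial big_ord_recr /= -/(zpartial u N) IH !big_cons.
by rewrite addrC addrA.
Qed.

Lemma mem_zseq k N : (k \in zseq N) = (match k with Posz n | Negz n => n < N end)%N.
Proof.
elim: N => [|N IH] /=; first by case: k.
rewrite !inE IH; case: k {IH} => n.
  by rewrite -[Posz n == Negz N]/false -[Posz n == Posz N]/(n == N) ltnS [RHS]leq_eqVlt.
by rewrite -[Negz n == Posz N]/false -[Negz n == Negz N]/(n == N) ltnS [RHS]leq_eqVlt.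
Qed.

Lemma zseq_uniq N : uniq (zseq N).
Proof.
elim: N => //= N IH; rewrite IH inE !mem_zseq !ltnn.
by rewrite -[Posz N == Negz N]/false.
Qed.

Lemma zseq_mono m n : (m <= n)%N -> {subset zseq m <= zseq n}.
Proof. by move=> mn k; rewrite !mem_zseq; case: k => i h; apply: leq_trans mn. Qed.

Lemma sub_zseq s : exists N, {subset s <= zseq N}.
Proof.
elim: s => [|k s [N hN]]; first by exists 0%N.
exists (maxn N (`|k|.+1)) => j; rewrite inE => /orP[/eqP->|/hN].
  by rewrite mem_zseq; case: k => n; lia.
by apply: zseq_mono; exact: leq_maxl.
Qed.

(** Absolute summability with an explicit bound, over duplicate-free finite lists: domination,
    reindexing and splitting then need no limits. *)
Definition sums_le u (M : R) : Prop :=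
  forall s, uniq s -> \sum_(k <- s) cabs (u k) <= M.

Lemma sums_le_ge0 u M : sums_le u M -> 0 <= M.
Proof. by move=> /(_ [::] isT); rewrite big_nil. Qed.

Lemma sums_le_dom u v M : (forall k, cabs (u k) <= cabs (v k)) ->
  sums_le v M -> sums_le u M.
Proof.
by move=> uv hv s us; apply: le_trans (hv s us); apply: ler_sum => k _; exact: uv.
Qed.

Lemma sums_leD u v M N : sums_le u M -> sums_le v N ->
  sums_le (fun k => u k + v k) (M + N).
Proof.
move=> hu hv s us; apply: le_trans (lerD (hu s us) (hv s us)).
by rewrite -big_split; apply: ler_sum => k _; exact: cabsD.
Qed.

Lemma sums_leZ c u M : sums_le u M -> sums_le (fun k => c * u k) (cabs c * M).
Proof.
move=> hu s us; under eq_bigr do rewrite cabsM.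
by rewrite -mulr_sumr ler_wpM2l ?cabs_ge0 ?hu.
Qed.

Lemma sums_le_mulr u v M N : sums_le u M -> 0 <= N -> (forall k, cabs (v k) <= N) ->
  sums_le (fun k => u k * v k) (M * N).
Proof.
move=> hu N0 hv s us; apply: le_trans (ler_wpM2r N0 (hu s us)); rewrite mulr_suml.
by apply: ler_sum => k _; rewrite cabsM ler_wpM2l ?cabs_ge0.
Qed.

Lemma sums_le_inj u M (g : int -> int) : injective g -> sums_le u M ->
  sums_le (fun k => u (g k)) M.
Proof.
move=> gi hu s us; rewrite -(big_map g predT (fun k => cabs (u k))).
by apply: hu; rewrite map_inj_uniq.
Qed.

Lemma sums_leJ u M : sums_le u M -> sums_le (fun k => (u k)^*) M.
Proof. by apply: sums_le_dom => k; rewrite cabsJ. Qed.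

Lemma sums_le_supp u s : (forall k, k \notin s -> u k = 0) ->
  sums_le u (\sum_(k <- undup s) cabs (u k)).
Proof.
move=> us t ut; rewrite (bigID (mem s)) /= [X in _ + X]big1; last first.
  by move=> k /us ->; rewrite cabs0.
rewrite addr0 -big_filter.
rewrite (sum_split_subset _ (undup_uniq s) (filter_uniq (mem s) ut)).
  by rewrite lerDl sumr_ge0 // => k _; exact: cabs_ge0.
by move=> k; rewrite mem_filter mem_undup => /andP[].
Qed.

(** A list [s0] whose sum is within [e] of the supremum of all finite sums leaves at most [e] to any
    list disjoint from it. *)
Lemma sums_le_tail u M : sums_le u M -> forall e : R, 0 < e ->
  exists s0, forall s, uniq s -> {in s, forall k, k \notin s0} ->
    \sum_(k <- s) cabs (u k) <= e.
Proof.
move=> hu e e0.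
pose S : set R := [set x | exists2 s, uniq s & x = \sum_(k <- s) cabs (u k)].
have hS : has_sup S.
  split; first by exists 0, [::] => //; rewrite big_nil.
  by exists M => x [s us ->]; exact: hu.
have [_ [s0 us0 ->] hs0] := sup_adherent e0 hS.
exists s0 => s us dis.
have : S (\sum_(k <- s0 ++ s) cabs (u k)).
  exists (s0 ++ s) => //; rewrite cat_uniq us0 us andbT; apply/hasPn => k.
  by move=> ks; exact: dis.
by move=> /(sup_upper_bound hS); rewrite big_cat /=; lra.
Qed.

(** Convergence along the net of finite sets. It refers to no enumeration of the integers, unlike
    [zsumC], so algebraic rules are proved for it and transferred. *)
Definition hassum u z : Prop := forall e : R, 0 < e ->
  exists s0, forall s, uniq s -> {subset s0 <= s} -> cabs (\sum_(k <- s) u k - z) <= e.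

Lemma hassum_unique u z w : hassum u z -> hassum u w -> z = w.
Proof.
move=> hz hw; apply/eqP; rewrite -subr_eq0; apply/eqP; apply: cabs_small => e e0.
have e20 : 0 < e / 2 by lra.
have [s0 h0] := hz _ e20; have [t0 k0] := hw _ e20.
set s := undup (s0 ++ t0).
have us : uniq s by exact: undup_uniq.
have h1 : {subset s0 <= s} by move=> k ks; rewrite mem_undup mem_cat ks.
have h2 : {subset t0 <= s} by move=> k ks; rewrite mem_undup mem_cat ks orbT.
have := h0 s us h1; have := k0 s us h2.
have := cabs_tri (\sum_(k <- s) u k) z w; rewrite (cabs_subC z (\sum_(k <- s) _)); lra.
Qed.

(** Pairing the terms at [n] and [-(n+1)] turns [zpartial] into an ordinary series, whose absolute
    partial sums are bounded by [M]. *)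
Lemma zpartial_cvg (v : int -> R) u M : (forall k, `|v k| <= cabs (u k)) ->
  sums_le u M -> cvgn (zpartial v).
Proof.
move=> vu hu.
pose w i := v (Posz i) + v (Negz i).
have -> : zpartial v = series w.
  by apply/funext => N; rewrite /series /= big_mkord.
apply: normed_cvg; apply: nondecreasing_is_cvgn.
  by apply: nondecreasing_series => n _ _; exact: normr_ge0.
exists M => _ [n _ <-]; apply: le_trans (hu _ (zseq_uniq n)).
rewrite -zpartialE /zpartial /= /series /= big_mkord; apply: ler_sum => i _.
by rewrite (le_trans (ler_normD _ _)) // lerD.
Qed.

Lemma hassum_zsumC u M : sums_le u M -> hassum u (zsumC u).
Proof.
(* Five shares of the error: one for passing from [s] to [zseq N], two for the limit of the real
   parts and two for that of the imaginary parts. *)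
move=> hu e e0; have e50 : 0 < e / 5 by lra.
have [s0 h0] := sums_le_tail hu e50.
have [N hN] := sub_zseq s0.
have hT s : uniq s -> {subset zseq N <= s} ->
    cabs (\sum_(k <- s) u k - \sum_(k <- zseq N) u k) <= e / 5.
  move=> us ss; rewrite (sum_split_subset _ us (zseq_uniq N) ss) addrAC subrr add0r.
  apply: le_trans (cabs_sum _ _) _; apply: h0; first exact: filter_uniq.
  move=> k; rewrite mem_filter => /andP[kN _]; apply: contra kN; exact: hN.
have lim_close (f : R[i] -> R) : (forall z, `|f z| <= cabs z) ->
    (forall (s : seq int), f (\sum_(k <- s) u k) = \sum_(k <- s) f (u k)) ->
    (forall z w, f (z - w) = f z - f w) ->
    `|limn (zpartial (fun k => f (u k))) - f (\sum_(k <- zseq N) u k)| <= 2 * (e / 5).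
  move=> fle fs fB.
  have cv : cvgn (zpartial (fun k => f (u k))).
    by apply: (@zpartial_cvg _ u M) => // k; exact: fle.
  have [n0 _ hn0] := (proj1 (cvgrPdist_le _ _) cv) _ e50.
  have := hn0 (maxn n0 N) (leq_maxl _ _); rewrite zpartialE -fs.
  have := hT _ (zseq_uniq (maxn n0 N)) (zseq_mono (leq_maxr n0 N)).
  move=> /(le_trans (fle _)); rewrite fB.
  set a := f _; set b := f _; set l := lim _.
  have := ler_normD (l - a) (a - b).
  have -> : l - a + (a - b) = l - b by rewrite addrA subrK.
  lra.
exists (zseq N) => s us ss.
have := hT s us ss.
have := cabs_tri (\sum_(k <- zseq N) u k) (\sum_(k <- s) u k) (zsumC u).
have := lim_close _ (@cabs_Re R) (fun s => Re_sum s u).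
have := lim_close _ (@cabs_Im R) (fun s => Im_sum s u).
have := cabs_le_ReIm (\sum_(k <- zseq N) u k - zsumC u).
have ReB (z w : R[i]) : complex.Re (z - w) = complex.Re z - complex.Re w.
  by case: z w => ? ? [].
have ImB (z w : R[i]) : complex.Im (z - w) = complex.Im z - complex.Im w.
  by case: z w => ? ? [].
rewrite ReB ImB => h1 /(_ ImB) h2 /(_ ReB) h3; move: h1 h2 h3.
rewrite /zsumC /= (distrC (complex.Re _)) (distrC (complex.Im _)); lra.
Qed.

Lemma zsumC_hassum u M z : sums_le u M -> hassum u z -> zsumC u = z.
Proof. by move=> hu; apply: hassum_unique; exact: hassum_zsumC hu. Qed.

Lemma hassumD u v z w : hassum u z -> hassum v w ->
  hassum (fun k => u k + v k) (z + w).
Proof.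
move=> hz hw e e0; have e20 : 0 < e / 2 by lra.
have [s0 h0] := hz _ e20; have [t0 k0] := hw _ e20.
exists (s0 ++ t0) => s us hs.
have h1 : {subset s0 <= s} by move=> k ks; apply: hs; rewrite mem_cat ks.
have h2 : {subset t0 <= s} by move=> k ks; apply: hs; rewrite mem_cat ks orbT.
have := h0 s us h1; have := k0 s us h2; rewrite big_split /= opprD addrACA.
have := cabsD (\sum_(k <- s) u k - z) (\sum_(k <- s) v k - w); lra.
Qed.

Lemma zsumCD u v M N : sums_le u M -> sums_le v N ->
  zsumC (fun k => u k + v k) = zsumC u + zsumC v.
Proof.
move=> hu hv; apply: zsumC_hassum (sums_leD hu hv) _.
by apply: hassumD; [exact: hassum_zsumC hu|exact: hassum_zsumC hv].
Qed.

Lemma zsumCZ c u M : sums_le u M -> zsumC (fun k => c * u k) = c * zsumC u.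
Proof.
move=> hu; apply: zsumC_hassum (sums_leZ c hu) _ => e e0.
have c0 := cabs_ge0 c.
have e10 : 0 < e / (cabs c + 1) by apply: divr_gt0 => //; lra.
have [s0 h0] := hassum_zsumC hu e10; exists s0 => s us hs.
rewrite -mulr_sumr -mulrBr cabsM.
apply: le_trans (ler_wpM2l c0 (h0 s us hs)) _.
rewrite mulrA ler_pdivrMr; last by lra.
by rewrite mulrC ler_wpM2l //; lra.
Qed.

Lemma zsumC_sum (I : Type) (s : seq I) (u : I -> int -> R[i]) (M : I -> R) :
  (forall i, sums_le (u i) (M i)) ->
  zsumC (fun k => \sum_(i <- s) u i k) = \sum_(i <- s) zsumC (u i).
Proof.
move=> hu; suff [N hN] : exists N, sums_le (fun k => \sum_(i <- s) u i k) N.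
  apply: zsumC_hassum hN _; elim: s => [|i s IH].
    rewrite big_nil => e e0; exists [::] => t _ _.
    by rewrite big1 ?subrr ?cabs0 ?ltW // => k _; rewrite big_nil.
  rewrite big_cons; under eq_fun do rewrite big_cons.
  by apply: hassumD => //; exact: hassum_zsumC (hu i).
elim: s => [|i s [N hN]].
  by exists 0 => t _; rewrite big1 // => k _; rewrite big_nil cabs0.
by exists (M i + N); under eq_fun do rewrite big_cons; exact: sums_leD.
Qed.

Lemma zsumC_conj u M : sums_le u M -> zsumC (fun k => (u k)^*) = (zsumC u)^*.
Proof.
move=> hu; apply: zsumC_hassum (sums_leJ hu) _ => e e0.
have [s0 h0] := hassum_zsumC hu e0; exists s0 => s us hs.
by rewrite -conjc_sum -rmorphB cabsJ h0.
Qed.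

Lemma zsumC_reindex (g h : int -> int) u M : cancel g h -> cancel h g ->
  sums_le u M -> zsumC (fun k => u (g k)) = zsumC u.
Proof.
move=> gh hg hu; apply: zsumC_hassum (sums_le_inj (can_inj gh) hu) _ => e e0.
have [s0 h0] := hassum_zsumC hu e0; exists (map h s0) => s us hs.
rewrite -(big_map g predT u); apply: h0; first by rewrite map_inj_uniq //; exact: can_inj gh.
by move=> k ks; apply/mapP; exists (h k); rewrite ?hg //; apply: hs; rewrite map_f.
Qed.

Lemma zsumC_supp u s : uniq s -> (forall k, k \notin s -> u k = 0) ->
  zsumC u = \sum_(k <- s) u k.
Proof.
move=> us hu; apply: zsumC_hassum (sums_le_supp hu) _ => e e0.
exists s => t ut st; rewrite (sum_split_subset _ ut us st).
have -> : \sum_(k <- [seq k <- t | k \notin s]) u k = 0.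
  by rewrite big_seq big1 // => k; rewrite mem_filter => /andP[/hu].
by rewrite addr0 subrr cabs0 ltW.
Qed.

Lemma zsumC_single u j : (forall k, k != j -> u k = 0) -> zsumC u = u j.
Proof.
move=> hu; rewrite (@zsumC_supp _ [:: j]) ?big_seq1 //.
by move=> k; rewrite inE => /hu.
Qed.

Lemma zsumC0 u : (forall k, u k = 0) -> zsumC u = 0.
Proof. by move=> hu; rewrite (@zsumC_supp _ [::]) ?big_nil. Qed.

(** Any large finite list splits into [s0] and a part disjoint from it, so a tail bound controls the
    error of the partial sum over [s0]. A bound [e] independent of the point gives uniform
    convergence. *)
Lemma cabs_zsumC_tail u M e s0 : sums_le u M -> uniq s0 ->
  (forall s, uniq s -> {in s, forall k, k \notin s0} ->
     \sum_(k <- s) cabs (u k) <= e) ->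
  cabs (zsumC u - \sum_(k <- s0) u k) <= e.
Proof.
move=> hu us0 hs; apply/ler_addgt0Pr => d d0.
have [t0 h0] := hassum_zsumC hu d0.
set s := undup (s0 ++ t0).
have us : uniq s by exact: undup_uniq.
have h1 : {subset s0 <= s} by move=> k ks; rewrite mem_undup mem_cat ks.
have h2 : {subset t0 <= s} by move=> k ks; rewrite mem_undup mem_cat ks orbT.
have := h0 s us h2; rewrite (sum_split_subset _ us us0 h1) (cabs_subC _ (zsumC u)) opprD addrA.
set S := \sum_(k <- [seq _ <- s | _]) _.
have hS : cabs S <= e.
  apply: le_trans (cabs_sum _ _) _; apply: hs; first exact: filter_uniq.
  by move=> k; rewrite mem_filter => /andP[].
have := cabsD (zsumC u - \sum_(k <- s0) u k - S) S; rewrite subrK; lra.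
Qed.

(** Replaces an interchange of infinite sums: one finite list [t] approximates the finitely many
    [zsumC (u n)] at once, so a bound on finite double sums passes to the limit. *)
Lemma sum_cabs_zsumC (I : Type) (s : seq I) (u : I -> int -> R[i]) M K :
  (forall n, sums_le (u n) M) ->
  (forall t, uniq t -> \sum_(n <- s) \sum_(k <- t) cabs (u n k) <= K) ->
  \sum_(n <- s) cabs (zsumC (u n)) <= K.
Proof.
move=> hu hK; apply/ler_addgt0Pr => e e0.
(* Each of the [size s] sums gets this share; the successor covers the empty list. *)
have d0 : 0 < e / (size s).+1%:R by rewrite divr_gt0 // ltr0n.
move: d0; set d := e / _ => d0.
have [t0 ht0] : exists t0, forall t, uniq t -> {subset t0 <= t} ->
    \sum_(n <- s) cabs (zsumC (u n)) <=
    \sum_(n <- s) \sum_(k <- t) cabs (u n k) + (size s)%:R * d.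
  move: d d0; elim: s {hK} => [|n s IH] d d0.
    by exists [::] => t _ _; rewrite !big_nil mul0r addr0.
  have [t1 h1] := IH d d0; have [t2 h2] := hassum_zsumC (hu n) d0.
  exists (t1 ++ t2) => t ut st; rewrite !big_cons.
  have /h1 h1' : {subset t1 <= t} by move=> k ks; apply: st; rewrite mem_cat ks.
  have /h2 h2' : {subset t2 <= t} by move=> k ks; apply: st; rewrite mem_cat ks orbT.
  have {h1'} := h1' ut; have {h2'} := h2' ut; rewrite cabs_subC.
  have := cabs_sum t (u n).
  set S := \sum_(k <- t) u n k.
  have := cabsD (zsumC (u n) - S) S; rewrite subrK /= -natr1; lra.
set t := undup t0.
have := ht0 t (undup_uniq _) _; have := hK t (undup_uniq _).
have h1 : {subset t0 <= t} by move=> k; rewrite mem_undup.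
have : (size s)%:R * d <= e.
  rewrite /d mulrA ler_pdivrMr ?ltr0n // mulrC ler_wpM2l ?ler_nat //; exact: ltW.
move=> h2 h3 /(_ h1); lra.
Qed.

Lemma zsumC_ge0 u M : sums_le u M -> (forall k, 0 <= u k) -> 0 <= zsumC u.
Proof.
move=> hu u0; rewrite complex_ge0 /zsumC /=.
have -> : zpartial (fun k => complex.Im (u k)) = (fun=> 0).
  apply/funext => N; rewrite zpartialE big1 // => k _.
  by have := u0 k; rewrite complex_ge0 => /andP[/eqP].
rewrite lim_cst // eqxx /=; apply: limr_ge.
  by apply: (zpartial_cvg _ hu) => k; exact: cabs_Re.
apply: nearW => N; rewrite zpartialE sumr_ge0 // => k _.
by have := u0 k; rewrite complex_ge0 => /andP[].
Qed.

(** A finite sum containing [k] dominates [u k] and can be taken within [e] of the total 0. *)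
Lemma zsumC_ge0_eq0 u M : sums_le u M -> (forall k, 0 <= u k) -> zsumC u = 0 ->
  forall k, u k = 0.
Proof.
move=> hu u0 z0 k; apply: cabs_small => e e0.
have [s0 h0] := hassum_zsumC hu e0; set s := undup (k :: s0).
have us : uniq s by exact: undup_uniq.
have := h0 s us; rewrite z0 subr0 => h; apply: le_trans (h _); last first.
  by move=> j js; rewrite mem_undup inE js orbT.
have ks : k \in s by rewrite mem_undup mem_head.
rewrite (bigD1_seq k) //=.
set T := \sum_(_ <- _ | _) _.
have T0 : 0 <= T by apply: sumr_ge0 => j _.
rewrite -lecR -!normE_cabs !ger0_norm ?addr_ge0 //.
by rewrite lerDl.
Qed.

End UnorderedSums.

(** * Continuous complex-valued functions *)

Section ContinuousComplexFunctions.
Variables (R : realType) (X : topologicalType).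
Implicit Types f g : X -> R[i].

Lemma ccontP f : ccont f <->
  forall x (e : R), 0 < e -> \forall y \near x, cabs (f x - f y) <= e.
Proof.
split=> [[cr ci] x e e0|h].
  have e20 : 0 < e / 2 by lra.
  have /cvgrPdist_le/(_ _ e20) hr := cr x.
  have /cvgrPdist_le/(_ _ e20) hi := ci x.
  apply: filterS2 hr hi => y; have := cabs_le_ReIm (f x - f y).
  by case: (f x) (f y) => a b [c d] /=; lra.
split=> x; apply/cvgrPdist_le => e e0; move: (h x e e0); apply: filterS => y.
  apply: le_trans; rewrite (_ : _ - _ = complex.Re (f x - f y)) ?cabs_Re //.
  by case: (f x) (f y) => a b [c d].
apply: le_trans; rewrite (_ : _ - _ = complex.Im (f x - f y)) ?cabs_Im //.
by case: (f x) (f y) => a b [c d].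
Qed.

Lemma ccont_uniform_limit f :
  (forall e : R, 0 < e -> exists2 g, ccont g & forall x, cabs (f x - g x) <= e) ->
  ccont f.
Proof.
move=> h; apply/ccontP => x e e0; have e30 : 0 < e / 3 by lra.
have [g /ccontP cg fg] := h _ e30.
move: (cg x _ e30); apply: filterS => y gxy.
have := fg x; have := fg y; rewrite (cabs_subC (f y)).
have := cabs_tri (g x) (f x) (f y); have := cabs_tri (g y) (g x) (f y); lra.
Qed.

Lemma ccont_cst (c : R[i]) : ccont (fun _ : X => c).
Proof. by split=> x; exact: cvg_cst. Qed.

Lemma ccontD f g : ccont f -> ccont g -> ccont (fun x => f x + g x).
Proof.
move=> [fr fi] [gr gi]; split.
  rewrite (_ : (fun _ => _) = (fun x => complex.Re (f x) + complex.Re (g x))).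
    by move=> x; apply: cvgD; [exact: fr|exact: gr].
  by apply/funext => x; case: (f x) (g x) => ? ? [].
rewrite (_ : (fun _ => _) = (fun x => complex.Im (f x) + complex.Im (g x))).
  by move=> x; apply: cvgD; [exact: fi|exact: gi].
by apply/funext => x; case: (f x) (g x) => ? ? [].
Qed.

Lemma ccontM f g : ccont f -> ccont g -> ccont (fun x => f x * g x).
Proof.
move=> [fr fi] [gr gi]; split.
  rewrite (_ : (fun _ => _) = (fun x => complex.Re (f x) * complex.Re (g x) -
      complex.Im (f x) * complex.Im (g x))).
    by move=> x; apply: cvgB; apply: cvgM; [exact: fr|exact: gr|exact: fi|exact: gi].
  by apply/funext => x; case: (f x) (g x) => ? ? [].
rewrite (_ : (fun _ => _) = (fun x => complex.Re (f x) * complex.Im (g x) +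
    complex.Im (f x) * complex.Re (g x))).
  by move=> x; apply: cvgD; apply: cvgM; [exact: fr|exact: gi|exact: fi|exact: gr].
by apply/funext => x; case: (f x) (g x) => ? ? [].
Qed.

Lemma ccont_conj f : ccont f -> ccont (fun x => (f x)^*).
Proof.
move=> /ccontP cf; apply/ccontP => x e e0; move: (cf x e e0).
by apply: filterS => y; rewrite -rmorphB cabsJ.
Qed.

Lemma ccont_comp f (h : X -> X) : continuous h -> ccont f -> ccont (fun x => f (h x)).
Proof.
move=> ch [fr fi].
split=> x.
  by apply: (@continuous_comp _ _ _ h (fun y => complex.Re (f y) : R)); [exact: ch|exact: fr].
by apply: (@continuous_comp _ _ _ h (fun y => complex.Im (f y) : R)); [exact: ch|exact: fi].
Qed.

Lemma ccont_sum (I : Type) (s : seq I) (F : I -> X -> R[i]) :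
  (forall i, ccont (F i)) -> ccont (fun x => \sum_(i <- s) F i x).
Proof.
move=> cF; elim: s => [|i s IH].
  by under eq_fun do rewrite big_nil; exact: ccont_cst.
by under eq_fun do rewrite big_cons; exact: ccontD.
Qed.

Lemma ccont_real (h : X -> R) : continuous h -> ccont (fun x => (h x)%:C).
Proof. by move=> ch; split=> //= x; exact: cvg_cst. Qed.

Lemma continuous_cabs f : ccont f -> continuous ((fun x => cabs (f x)) : X -> R).
Proof.
move=> /ccontP cf x; apply/cvgrPdist_le => e e0; move: (cf x e e0).
apply: filterS => y; apply: le_trans.
rewrite ler_norml; apply/andP; split.
  have := cabsD (f y - f x) (f x); rewrite subrK cabs_subC; lra.
have := cabsD (f x - f y) (f y); rewrite subrK; lra.
Qed.

(** The non-vanishing set of [f] is open. This upgrades supports inside [Fix_k] to supports inside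
    its interior. *)
Lemma ccont_neq0_interior f (P : set X) x : ccont f ->
  (forall y, f y != 0 -> P y) -> f x != 0 -> interior P x.
Proof.
move=> /ccontP cf fP fx.
have e0 : 0 < cabs (f x) / 2.
  rewrite divr_gt0 // lt_neqAle cabs_ge0 andbT eq_sym.
  by apply: contra fx => /eqP/cabs_eq0 ->.
have := cf x _ e0; apply: filterS => y hy; apply: fP; apply/eqP => fy0.
by move: hy; rewrite fy0 subr0; lra.
Qed.

End ContinuousComplexFunctions.

(** * Integer iterates and the interiors of their fixed-point sets *)

Section Iterates.
Variables (X : topologicalType) (sigma sigmai : X -> X).
Hypotheses (hcs : continuous sigma) (hcsi : continuous sigmai).
Hypotheses (hK1 : cancel sigma sigmai) (hK2 : cancel sigmai sigma).
Local Notation iterz := (iterz sigma sigmai).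

Lemma iterz_succ m x : iterz (m + 1) x = sigma (iterz m x).
Proof.
case: m => [n|[|n]].
- by have -> : Posz n + 1 = Posz n.+1 by lia.
- by have -> : Negz 0 + 1 = 0 :> int; last by rewrite /= hK2.
- by have -> : Negz n.+1 + 1 = Negz n; [lia | rewrite /= hK2].
Qed.

Lemma iterz_pred m x : iterz (m - 1) x = sigmai (iterz m x).
Proof. by rewrite -[m in RHS](subrK 1) iterz_succ hK1. Qed.

Lemma iterzD m n x : iterz (m + n) x = iterz m (iterz n x).
Proof.
elim/int_rec: m => [|m IH|m IH]; first by rewrite add0r.
  by rewrite -addn1 PoszD addrAC !iterz_succ IH.
by rewrite -addn1 PoszD opprD addrAC !iterz_pred IH.
Qed.

Lemma iterzK k x : iterz k (iterz (- k) x) = x.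
Proof. by rewrite -iterzD subrr. Qed.

Lemma iterzNK k x : iterz (- k) (iterz k x) = x.
Proof. by rewrite -iterzD addNr. Qed.

Lemma iterz_fixN k x : iterz k x = x -> iterz (- k) x = x.
Proof. by move=> h; rewrite -[in LHS]h iterzNK. Qed.

Lemma continuous_iter (f : X -> X) n : continuous f -> continuous (iter n f).
Proof.
move=> cf; elim: n => [|n IH] x /=; first exact: cvg_id.
by apply: (@continuous_comp _ _ _ (iter n f) f); [exact: IH|exact: cf].
Qed.

Lemma continuous_iterz k : continuous (iterz k).
Proof. by case: k => n; exact: continuous_iter. Qed.

Lemma interior_Fixk0 x : interior (Fixk sigma sigmai 0) x.
Proof. by rewrite /Fixk /= (_ : [set _ | _] = setT) ?interiorT //; apply/seteqP. Qed.

Lemma interior_FixkN k x :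
  interior (Fixk sigma sigmai k) x -> interior (Fixk sigma sigmai (- k)) x.
Proof. by apply: filterS => y; exact: iterz_fixN. Qed.

(** Iterates commute, so the preimage of [Fix_k] under [iterz j] lies in [Fix_k]; continuity makes
    this preimage a neighbourhood of [x]. *)
Lemma interior_Fixk_iterz j k x : interior (Fixk sigma sigmai k) (iterz j x) ->
  interior (Fixk sigma sigmai k) x.
Proof.
move=> kx.
have : nbhs x (iterz j @^-1` Fixk sigma sigmai k) := @continuous_iterz j x _ kx.
apply: filterS => y; rewrite /Fixk /= => h.
by rewrite -[RHS](iterzNK j y) -h -!iterzD; congr (iterz _ y); ring.
Qed.

(** With [interior_Fixk0] and [interior_FixkN]: at each [x] the exponents [k] with [x] in the
    interior of [Fix_k] form a subgroup of the integers. Its cosets are the equivalence classes of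
    the averaging argument. *)
Lemma interior_FixkD m n x : interior (Fixk sigma sigmai m) x ->
  interior (Fixk sigma sigmai n) x -> interior (Fixk sigma sigmai (m + n)) x.
Proof. by move=> hm hn; apply: filterS2 hm hn => y; rewrite /Fixk /= iterzD => hm ->. Qed.

End Iterates.

(** * Separating a point from a closed set *)

Section Urysohn.
Variables (R : realType) (X : topologicalType).
Hypotheses (hcpt : compact [set: X]) (hT2 : hausdorff_space X).

Lemma ccont_separation (A : set X) (x : X) : closed A -> ~ A x ->
  exists f : X -> R[i], [/\ ccont f, f x = 1 & forall y, A y -> f y = 0].
Proof.
move=> cA Ax; have nX : normal_space X by exact: compact_normal.
have cx : closed [set x].
  by apply: accessible_closed_set1; exact: hausdorff_accessible.
have /(@uniform_separatorP _ R)[f [cf _ f0 f1]] : uniform_separator A [set x].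
  apply: normal_uniform_separator => //.
  by rewrite -subset0 => y [Ay yx]; apply: Ax; rewrite -yx.
exists (fun y => (f y)%:C); split; first exact: ccont_real.
  by rewrite (_ : f x = 1) //; apply: f1; exists x.
by move=> y Ay; rewrite (_ : f y = 0) //; apply: f0; exists y.
Qed.

End Urysohn.

(** * The algebra [l^1] and the commutant of [C(X)] *)

Section L1Algebra.
Variables (R : realType) (X : topologicalType) (sigma sigmai : X -> X).
Hypotheses (hne : [set: X] !=set0) (hcpt : compact [set: X]) (hT2 : hausdorff_space X).
Hypotheses (hcs : continuous sigma) (hcsi : continuous sigmai).
Hypotheses (hK1 : cancel sigma sigmai) (hK2 : cancel sigmai sigma).
Local Notation iterz := (iterz sigma sigmai).
Local Notation sermul := (sermul sigma sigmai).
Local Notation serstar := (serstar sigma sigmai).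
Local Notation ser := (ser R X).
Implicit Types (a b l : ser) (f g : X -> R[i]) (k m n : int) (x : X) (c d : R[i]).

Lemma serP a b : (forall k x, a k x = b k x) -> a = b.
Proof. by move=> h; apply/funext => k; apply/funext => x. Qed.

Lemma supnorm_attained f : ccont f ->
  exists2 x, supnorm f = cabs (f x) & forall y, cabs (f y) <= cabs (f x).
Proof.
move=> cf.
have cw : {within [set: X], continuous ((fun x => cabs (f x)) : X -> R)}.
  by apply: continuous_subspaceT; exact: continuous_cabs.
have [x _ hx] := compact_EVT_max hne hcpt cw.
have hx' y : cabs (f y) <= cabs (f x) by apply: hx; rewrite in_setT.
exists x => //; apply/eqP; rewrite eq_le; apply/andP; split.
  apply: ge_sup; first by exists (cabs (f x)), x.
  by move=> _ [y _ <-].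
by apply: ub_le_sup; [exists (cabs (f x)) => _ [y _ <-]|exists x].
Qed.

(* [sum_k sup_x |l k x| <= M], with the suprema replaced by arbitrary choices of
   points: in this form the bound passes to pointwise limits. *)
Definition l1le l (M : R) : Prop := forall p : int -> X, sums_le (fun k => l k (p k)) M.

(** Evaluating each coefficient at a maximizer replaces the sup norms by the moduli of one scalar
    family, to which the results on unordered sums apply. *)
Lemma max_points l : (forall k, ccont (l k)) -> exists p : int -> X,
  forall k, supnorm (l k) = cabs (l k (p k)) /\ forall y, cabs (l k y) <= cabs (l k (p k)).
Proof.
move=> cl.
have /choice[p hp] : forall k, exists x, supnorm (l k) = cabs (l k x) /\
    forall y, cabs (l k y) <= cabs (l k x).
  by move=> k; have [x h1 h2] := supnorm_attained (cl k); exists x.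
by exists p.
Qed.

Lemma in_l1_ccont l k : in_l1 l -> ccont (l k).
Proof. by case. Qed.

Lemma l1norm_le l (M : R) : in_l1 l -> l1le l M -> l1norm l <= M.
Proof.
move=> [cl cv] hl; apply: limr_le => //; apply: nearW => N.
have [p hp] := max_points cl; rewrite zpartialE.
rewrite (eq_bigr (fun k => cabs (l k (p k)))); last by move=> k _; case: (hp k).
by apply: hl; exact: zseq_uniq.
Qed.

Lemma l1le_l1norm l : in_l1 l -> l1le l (l1norm l).
Proof.
move=> [cl cv] q s us; have [p hp] := max_points cl.
have [N hN] := sub_zseq s.
have : zpartial (fun k => supnorm (l k)) N <= l1norm l.
  apply: nondecreasing_cvgn_le => // m n mn; rewrite !zpartialE.
  rewrite (sum_split_subset _ (zseq_uniq n) (zseq_uniq m) (zseq_mono mn)).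
  by rewrite lerDl sumr_ge0 // => k _; case: (hp k) => -> _; exact: cabs_ge0.
apply: le_trans; rewrite zpartialE (sum_split_subset _ (zseq_uniq N) us hN).
rewrite -[leLHS]addr0 lerD //.
  by apply: ler_sum => k _; case: (hp k) => ->.
by apply: sumr_ge0 => k _; case: (hp k) => -> _; exact: cabs_ge0.
Qed.

Lemma in_l1_bound l : in_l1 l -> exists M, l1le l M.
Proof. by move=> hl; exists (l1norm l); exact: l1le_l1norm. Qed.

Lemma in_l1I l (M : R) : (forall k, ccont (l k)) -> l1le l M -> in_l1 l.
Proof.
move=> cl hl; split=> //; have [p hp] := max_points cl.
apply: (@zpartial_cvg _ _ (fun k => l k (p k)) M) => // k.
by case: (hp k) => -> _; rewrite ger0_norm ?cabs_ge0.
Qed.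

Lemma l1le_sums l (M : R) x : l1le l M -> sums_le (fun k => l k x) M.
Proof. by move=> hl; exact: (hl (fun=> x)). Qed.

Lemma l1le_cabs l (M : R) k x : l1le l M -> cabs (l k x) <= M.
Proof. by move=> /(l1le_sums x)/(_ [:: k] isT); rewrite big_seq1. Qed.

Lemma l1le_ge0 l (M : R) : l1le l M -> 0 <= M.
Proof. by case: hne => x _ /(l1le_sums x)/sums_le_ge0. Qed.

Lemma l1le_weak l (M N : R) : M <= N -> l1le l M -> l1le l N.
Proof. by move=> MN h p s us; apply: le_trans MN; exact: h. Qed.

Lemma l1le_dom a b (M : R) : (forall k x, cabs (a k x) <= cabs (b k x)) ->
  l1le b M -> l1le a M.
Proof. by move=> ab hb p; apply: sums_le_dom (hb p) => k; exact: ab. Qed.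

Lemma l1leD a b (M N : R) : l1le a M -> l1le b N -> l1le (seradd a b) (M + N).
Proof. by move=> ha hb p; exact: sums_leD (ha p) (hb p). Qed.

Lemma l1leZ c a (M : R) : l1le a M -> l1le (serscale c a) (cabs c * M).
Proof. by move=> ha p; exact: sums_leZ (ha p). Qed.

Lemma l1le_star a (M : R) : l1le a M -> l1le (serstar a) M.
Proof.
move=> ha p; rewrite /Defs.serstar.
apply: (sums_leJ (u := fun k => a (- k) (iterz (- k) (p k)))).
(* This choice of points takes the value [iterz (- k) (p k)] at the index [- k], exactly where the
   involution evaluates [a (- k)]. *)
have := sums_le_inj (@oppr_inj _) (ha (fun k => iterz k (p (- k)))).
by apply: sums_le_dom => k; rewrite opprK.
Qed.

Lemma in_l1D a b : in_l1 a -> in_l1 b -> in_l1 (seradd a b).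
Proof.
move=> ha hb; have [M hM] := in_l1_bound ha; have [N hN] := in_l1_bound hb.
apply: in_l1I (l1leD hM hN) => k.
by apply: ccontD; exact: in_l1_ccont.
Qed.

Lemma in_l1Z c a : in_l1 a -> in_l1 (serscale c a).
Proof.
move=> ha; have [M hM] := in_l1_bound ha.
apply: in_l1I (l1leZ c hM) => k; apply: ccontM; [exact: ccont_cst|exact: in_l1_ccont].
Qed.

Lemma in_l1_lin c d a b : in_l1 a -> in_l1 b ->
  in_l1 (seradd (serscale c a) (serscale d b)).
Proof. by move=> ha hb; apply: in_l1D; exact: in_l1Z. Qed.

Lemma in_l1_star a : in_l1 a -> in_l1 (serstar a).
Proof.
move=> ha; have [M hM] := in_l1_bound ha.
apply: in_l1I (l1le_star hM) => k; apply: ccont_conj.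
by apply: (ccont_comp (f := a (- k))); [exact: continuous_iterz|exact: in_l1_ccont].
Qed.

Lemma sermul_sums a b (M N : R) n x : l1le a M -> l1le b N ->
  sums_le (fun k => a k x * b (n - k) (iterz (- k) x)) (M * N).
Proof.
move=> ha hb; apply: sums_le_mulr (l1le_sums x ha) (l1le_ge0 hb) _ => k.
exact: l1le_cabs.
Qed.

(** Submultiplicativity of the norm: after exchanging the sums, [a k] is bounded by its maximum, and
    for fixed [k] the sum over [n] is a translated sum for [b] with its own choice of points. *)
Lemma l1leM a b (M N : R) : (forall k, ccont (a k)) -> l1le a M -> l1le b N ->
  l1le (sermul a b) (M * N).
Proof.
move=> ca ha hb q s us; have [p hp] := max_points ca; have N0 := l1le_ge0 hb.
apply: (@sum_cabs_zsumC _ _ _ (fun n k => a k (q n) * b (n - k) (iterz (- k) (q n))) (M * N)).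
  by move=> n; exact: sermul_sums.
move=> t ut; rewrite exchange_big /=.
apply: le_trans (ler_wpM2r N0 (ha p t ut)); rewrite mulr_suml.
apply: ler_sum => k _.
apply: (@le_trans _ _ (\sum_(n <- s)
    cabs (a k (p k)) * cabs (b (n - k) (iterz (- k) (q n))))).
  by apply: ler_sum => n _; rewrite cabsM ler_wpM2r ?cabs_ge0 //; case: (hp k).
rewrite -mulr_sumr ler_wpM2l ?cabs_ge0 //.
have := sums_le_inj (addIr (- k)) (hb (fun j => iterz (- k) (q (j + k)))) us.
by under eq_bigr do rewrite subrK.
Qed.

(** Continuity of a coefficient comes from uniform convergence: the tail of the sum is at most a
    tail of the sup norms of [a] times the bound of [b]. *)
Lemma in_l1M a b : in_l1 a -> in_l1 b -> in_l1 (sermul a b).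
Proof.
move=> ha hb; have [M hM] := in_l1_bound ha; have [N hN] := in_l1_bound hb.
have ca k : ccont (a k) by exact: in_l1_ccont.
apply: in_l1I (l1leM ca hM hN) => n; have N0 := l1le_ge0 hN.
apply: ccont_uniform_limit => e e0; have [p hp] := max_points ca.
have e10 : 0 < e / (N + 1) by apply: divr_gt0; lra.
have [s0 hs0] := sums_le_tail (hM p) e10.
exists (fun x => \sum_(k <- undup s0) a k x * b (n - k) (iterz (- k) x)).
  apply: ccont_sum => k; apply: ccontM => //.
  by apply: (ccont_comp (f := b (n - k))); [exact: continuous_iterz|exact: in_l1_ccont].
move=> x; apply: cabs_zsumC_tail (sermul_sums n x hM hN) (undup_uniq _) _ => s us dis.
have {dis} hs : \sum_(k <- s) cabs (a k (p k)) <= e / (N + 1).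
  by apply: hs0 => // k /dis; rewrite mem_undup.
apply: (@le_trans _ _ (\sum_(k <- s) cabs (a k (p k)) * N)).
  apply: ler_sum => k _; rewrite cabsM; apply: ler_pM; rewrite ?cabs_ge0 //.
    by case: (hp k).
  exact: l1le_cabs.
rewrite -mulr_suml; apply: le_trans (ler_wpM2r N0 hs) _.
by rewrite mulrAC ler_pdivrMr ?ler_wpM2l; lra.
Qed.

Lemma sermul_linl c d a b l : in_l1 a -> in_l1 b -> in_l1 l ->
  sermul (seradd (serscale c a) (serscale d b)) l =
  seradd (serscale c (sermul a l)) (serscale d (sermul b l)).
Proof.
move=> /in_l1_bound[M hM] /in_l1_bound[N hN] /in_l1_bound[K hK].
apply: serP => n x; rewrite /Defs.sermul /seradd /serscale.
rewrite -(zsumCZ c (sermul_sums n x hM hK)) -(zsumCZ d (sermul_sums n x hN hK)).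
rewrite -(zsumCD (sums_leZ c (sermul_sums n x hM hK)) (sums_leZ d (sermul_sums n x hN hK))).
by congr zsumC; apply/funext => k; ring.
Qed.

Lemma sermul_linr c d a b l : in_l1 a -> in_l1 b -> in_l1 l ->
  sermul l (seradd (serscale c a) (serscale d b)) =
  seradd (serscale c (sermul l a)) (serscale d (sermul l b)).
Proof.
move=> /in_l1_bound[M hM] /in_l1_bound[N hN] /in_l1_bound[K hK].
apply: serP => n x; rewrite /Defs.sermul /seradd /serscale.
rewrite -(zsumCZ c (sermul_sums n x hK hM)) -(zsumCZ d (sermul_sums n x hK hN)).
rewrite -(zsumCD (sums_leZ c (sermul_sums n x hK hM)) (sums_leZ d (sermul_sums n x hK hN))).
by congr zsumC; apply/funext => k; ring.
Qed.

Lemma serstar_lin c d a b :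
  serstar (seradd (serscale c a) (serscale d b)) =
  seradd (serscale c^*%C (serstar a)) (serscale d^*%C (serstar b)).
Proof.
by apply: serP => n x; rewrite /Defs.serstar /seradd /serscale rmorphD !rmorphM.
Qed.

Lemma serstarK a : serstar (serstar a) = a.
Proof. by apply: serP => n x; rewrite /Defs.serstar conjcK !opprK iterzK. Qed.

Lemma serstar_mul a b : in_l1 a -> in_l1 b ->
  serstar (sermul a b) = sermul (serstar b) (serstar a).
Proof.
move=> ha hb; have [M hM] := in_l1_bound ha; have [N hN] := in_l1_bound hb.
apply: serP => n x; rewrite /Defs.serstar /Defs.sermul.
rewrite -(zsumC_conj (sermul_sums _ _ hM hN)).
(* Substituting [n + k] for [k] in the right-hand product pairs [a k] with [b (- n - k)], as on the
   left. *)
have gK : cancel (fun k => n + k) (fun k => k - n) by move=> k; rewrite addrC addKr.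
have Kg : cancel (fun k => k - n) (fun k => n + k) by move=> k; rewrite addrC subrK.
rewrite -[RHS](zsumC_reindex gK Kg (sermul_sums n x (l1le_star hN) (l1le_star hM))).
congr zsumC; apply/funext => k; rewrite rmorphM mulrC /Defs.serstar.
have -> : - (n - (n + k)) = k by ring.
rewrite -!(iterzD hK1 hK2).
have -> : - k + - n = - (n + k) by ring.
have -> : - n - k = - (n + k) by ring.
by have -> : k - (n + k) = - n by ring.
Qed.

Lemma l1le_emb f (M : R) : 0 <= M -> (forall x, cabs (f x) <= M) -> l1le (emb f) M.
Proof.
move=> M0 hf p s us.
have h k : k \notin [:: 0] -> emb f k (p k) = 0 by rewrite inE /emb => /negbTE ->.
apply: le_trans (sums_le_supp h us) _.
by rewrite /= big_seq1 /emb eqxx.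
Qed.

Lemma in_l1_emb f : ccont f -> in_l1 (emb f).
Proof.
move=> cf; have [x _ hx] := supnorm_attained cf.
apply: in_l1I (l1le_emb (cabs_ge0 _) hx) => k; rewrite /emb; case: (k == 0) => //.
exact: ccont_cst.
Qed.

Lemma in_l1_ser1 : in_l1 (@ser1 R X).
Proof. by apply: in_l1_emb; exact: ccont_cst. Qed.

Lemma sermul_embl f l n x : sermul (emb f) l n x = f x * l n x.
Proof.
rewrite /Defs.sermul (@zsumC_single _ _ 0) /emb ?eqxx ?subr0 ?oppr0 //.
by move=> k /negbTE ->; rewrite mul0r.
Qed.

Lemma sermul_embr f l n x : sermul l (emb f) n x = l n x * f (iterz (- n) x).
Proof.
rewrite /Defs.sermul (@zsumC_single _ _ n) /emb ?subrr //.
by move=> k kn; rewrite subr_eq0 eq_sym (negbTE kn) mulr0.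
Qed.

Lemma sermul1l l : sermul (@ser1 R X) l = l.
Proof. by apply: serP => n x; rewrite sermul_embl mul1r. Qed.

Lemma sermul1r l : sermul l (@ser1 R X) = l.
Proof. by apply: serP => n x; rewrite sermul_embr mulr1. Qed.

Lemma serstar1 : serstar (@ser1 R X) = @ser1 R X.
Proof.
apply: serP => n x; rewrite /Defs.serstar /ser1 /emb oppr_eq0.
by case: (n == 0); rewrite ?rmorph1 ?rmorph0.
Qed.

Definition fixsupp l : Prop := forall k x, l k x != 0 -> iterz k x = x.

(** Commuting with [f] means that [l_k(x)] is killed by [f(x) - f(sigma^{-k} x)]; an [f] separating
    the two points exists unless [x] is fixed. *)
Lemma commuteP l : (forall f, ccont f -> sermul (emb f) l = sermul l (emb f)) <-> fixsupp l.
Proof.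
split=> [h k x|h f cf].
  apply: contraNP => kx.
  have cx : closed [set iterz (- k) x].
    by apply: accessible_closed_set1; exact: hausdorff_accessible.
  have [|f [cf fx f0]] := @ccont_separation R _ hcpt hT2 _ x cx.
    by move=> /= e; apply: kx; rewrite [in LHS]e iterzK.
  have := congr1 (fun l : ser => l k x) (h f cf).
  by rewrite sermul_embl sermul_embr fx mul1r f0 // mulr0 => ->.
apply: serP => n x; rewrite sermul_embl sermul_embr.
have [->|/h/(iterz_fixN hK1 hK2) ->] := eqVneq (l n x) 0; first by rewrite mulr0 mul0r.
exact: mulrC.
Qed.

Lemma comm1P l : comm1 sigma sigmai l <-> in_l1 l /\ fixsupp l.
Proof. by rewrite /comm1 commuteP. Qed.

Lemma comm00P l : comm00 sigma sigmai l <-> in_c00 l /\ fixsupp l.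
Proof. by rewrite /comm00 commuteP. Qed.

Lemma fixsupp_interior l k x : ccont (l k) -> fixsupp l -> l k x != 0 ->
  interior (Fixk sigma sigmai k) x.
Proof.
by move=> cl fl; apply: ccont_neq0_interior cl _ => y; exact: fl.
Qed.

Lemma fixsupp_lin c d a b : fixsupp a -> fixsupp b ->
  fixsupp (seradd (serscale c a) (serscale d b)).
Proof.
move=> fa fb k x; rewrite /seradd /serscale.
have [a0|/fa //] := eqVneq (a k x) 0; have [b0|/fb //] := eqVneq (b k x) 0.
by rewrite a0 b0 !mulr0 addr0 eqxx.
Qed.

(** A nonzero term of the product at [x] makes [x] fixed by both [sigma^k] and [sigma^{n-k}]. *)
Lemma fixsuppM a b : fixsupp a -> fixsupp b -> fixsupp (sermul a b).
Proof.
move=> fa fb n x; apply: contraNP => nx; apply/eqP; apply: zsumC0 => k.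
have [->|/fa kx] := eqVneq (a k x) 0; first by rewrite mul0r.
have kx' := iterz_fixN hK1 hK2 kx; rewrite kx'.
have [->|/fb nkx] := eqVneq (b (n - k) x) 0; first by rewrite mulr0.
by case: nx; rewrite -[n](subrK k) (iterzD hK1 hK2) kx.
Qed.

Lemma fixsupp_star a : fixsupp a -> fixsupp (serstar a).
Proof.
move=> fa n x; rewrite /Defs.serstar conjc_eq0 => /fa h.
have {h} := congr1 (iterz n) h; rewrite !(iterzK hK1 hK2) => e.
by rewrite -[in LHS]e (iterzK hK1 hK2).
Qed.

Lemma fixsupp1 : fixsupp (@ser1 R X).
Proof. by move=> k x; rewrite /ser1 /emb; have [->|] := eqVneq k 0; rewrite ?eqxx. Qed.

(* On the commutant the action disappears: at each [x] the product is a convolution. *)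
Lemma sermul_star_fixsupp a n x : fixsupp a ->
  sermul (serstar a) a n x = zsumC (fun k => (a (- k) x)^*%C * a (n - k) x).
Proof.
move=> fa; congr zsumC; apply/funext => k; rewrite /Defs.serstar.
have [ex|ne] := pselect (iterz (- k) x = x); first by rewrite ex.
have -> : a (- k) x = 0 by have [//|/fa] := eqVneq (a (- k) x) 0.
suff -> : a (- k) (iterz (- k) x) = 0 by rewrite conjc0 !mul0r.
have [//|/fa h] := eqVneq (a (- k) (iterz (- k) x)) 0; case: ne.
by have := congr1 (iterz k) h; rewrite !(iterzK hK1 hK2).
Qed.

Lemma star_sums a (M : R) i j x : l1le a M ->
  sums_le (fun k => (a (i - k) x)^*%C * a (j - k) x) (M * M).
Proof.
move=> hM; apply: sums_le_mulr => [||k]; [|exact: l1le_ge0 hM|exact: l1le_cabs].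
apply: sums_leJ; apply: (sums_le_inj (u := fun k => a k x)) (l1le_sums x hM).
by move=> p q /addrI/oppr_inj.
Qed.

End L1Algebra.

(** * Completeness of [l^1] and square roots of [1 - h] *)

Section SquareRoot.
Variables (R : realType) (X : topologicalType) (sigma sigmai : X -> X).
Hypotheses (hne : [set: X] !=set0) (hcpt : compact [set: X]) (hT2 : hausdorff_space X).
Hypotheses (hcs : continuous sigma) (hcsi : continuous sigmai).
Hypotheses (hK1 : cancel sigma sigmai) (hK2 : cancel sigmai sigma).
Local Notation iterz := (iterz sigma sigmai).
Local Notation sermul := (sermul sigma sigmai).
Local Notation serstar := (serstar sigma sigmai).
Local Notation ser := (ser R X).
Local Notation fixsupp := (@fixsupp R X sigma sigmai).
Implicit Types (a b l : ser) (f g : X -> R[i]) (k : int) (x : X) (c d : R[i]).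

Definition sersub a b : ser := seradd (serscale 1 a) (serscale (-1) b).

Lemma sersubE a b k x : sersub a b k x = a k x - b k x.
Proof. by rewrite /sersub /seradd /serscale mul1r mulN1r. Qed.

Lemma in_l1B a b : in_l1 a -> in_l1 b -> in_l1 (sersub a b).
Proof. exact: in_l1_lin. Qed.

Lemma l1le_subC a b (M : R) : l1le (sersub a b) M -> l1le (sersub b a) M.
Proof. by apply: l1le_dom => k x; rewrite !sersubE cabs_subC. Qed.

(** From [a b - a' b' = a (b - b') + (a - a') b']. *)
Lemma l1le_mul_sub a b a' b' (M N D D' : R) :
  in_l1 a -> in_l1 b -> in_l1 a' -> in_l1 b' -> l1le a M -> l1le b' N ->
  l1le (sersub a a') D -> l1le (sersub b b') D' ->
  l1le (sersub (sermul a b) (sermul a' b')) (M * D' + D * N).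
Proof.
move=> ia ib ia' ib' hM hN hD hD'; have iaa := in_l1B ia ia'.
have h1 := l1leM sigma sigmai hne hcpt (fun k => in_l1_ccont k ia) hM hD'.
have h2 := l1leM sigma sigmai hne hcpt (fun k => in_l1_ccont k iaa) hD hN.
have := l1leD h1 h2; apply: l1le_dom => k x; rewrite le_eqVlt; apply/predU1P; left.
congr cabs; rewrite sersubE /seradd /sersub (sermul_linr sigma sigmai hne hcpt) //.
by rewrite (sermul_linl sigma sigmai hne hcpt) // /seradd /serscale; ring.
Qed.

(** The intervals of radius [d n] around [v n] meet pairwise, so the supremum of their left
    endpoints lies in all of them; the rate is kept explicit. *)
Lemma real_cauchy_limit (v d : nat -> R) : (forall n, 0 <= d n) ->
  (forall n m, (n <= m)%N -> `|v n - v m| <= d n) ->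
  exists L, forall n, `|v n - L| <= d n.
Proof.
move=> d0 hv.
have key n m : v n - d n <= v m + d m.
  have := d0 n; have := d0 m.
  have [nm|/ltnW mn] := leqP n m.
    by have := hv n m nm; rewrite ler_norml => /andP[]; lra.
  by have := hv m n mn; rewrite ler_norml => /andP[]; lra.
pose S : set R := [set v n - d n | n in [set: nat]].
have S0 : S !=set0 by exists (v 0%N - d 0%N), 0%N.
exists (sup S) => n; rewrite ler_norml; apply/andP; split.
  suff : sup S <= v n + d n by lra.
  by apply: ge_sup => // _ [m _ <-].
suff : v n - d n <= sup S by lra.
by apply: ub_le_sup; [exists (v 0%N + d 0%N) => _ [m _ <-]|exists n].
Qed.

Lemma complex_cauchy_limit (z : nat -> R[i]) (d : nat -> R) : (forall n, 0 <= d n) ->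
  (forall n m, (n <= m)%N -> cabs (z n - z m) <= d n) ->
  exists L, forall n, cabs (z n - L) <= 2 * d n.
Proof.
move=> d0 hz.
have [a ha] : exists L, forall n, `|complex.Re (z n) - L| <= d n.
  apply: real_cauchy_limit => // n m nm; apply: le_trans (hz n m nm).
  rewrite (_ : _ - _ = complex.Re (z n - z m)) ?cabs_Re //.
  by case: (z n) (z m) => ? ? [].
have [b hb] : exists L, forall n, `|complex.Im (z n) - L| <= d n.
  apply: real_cauchy_limit => // n m nm; apply: le_trans (hz n m nm).
  rewrite (_ : _ - _ = complex.Im (z n - z m)) ?cabs_Im //.
  by case: (z n) (z m) => ? ? [].
exists (a +i* b) => n; have := cabs_le_ReIm (z n - (a +i* b)).
by have := ha n; have := hb n; case: (z n) => p q /=; lra.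
Qed.

Lemma pow2_small (C e : R) (n : nat) : 0 < e ->
  exists2 m, (n <= m)%N & C * 2^-1 ^+ m <= e.
Proof.
move=> e0; pose m := maxn n (Num.Def.archi_bound (C / e)).
exists m; first exact: leq_maxl.
rewrite exprVn ler_pdivrMr ?exprn_gt0 // mulrC -ler_pdivrMr //.
have [C0|/ltW C0] := leP 0 (C / e); last by apply: le_trans C0 _; rewrite exprn_ge0.
apply: le_trans (ltW (archi_boundP C0)) _.
rewrite -natrX ler_nat; apply: leq_trans (leq_maxr n _) _.
exact/ltnW/ltn_expl.
Qed.

(** Coefficients converge pointwise, and [l1le] bounds survive since each involves finitely many
    points; continuity of the limit is a uniform-limit argument. *)
Lemma l1_complete (Y : nat -> ser) : (forall n, in_l1 (Y n)) ->
  (forall n, l1le (sersub (Y n.+1) (Y n)) (2^-1 ^+ n)) ->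
  exists y, in_l1 y /\ forall n, l1le (sersub (Y n) y) (2 * 2^-1 ^+ n).
Proof.
move=> hY hD.
have tele n j : l1le (sersub (Y (n + j)%N) (Y n)) (2 * 2^-1 ^+ n - 2 * 2^-1 ^+ (n + j)).
  elim: j => [|j IH].
    rewrite addn0 subrr => p s us; rewrite big1 // => k _.
    by rewrite sersubE subrr cabs0.
  have -> : 2 * 2^-1 ^+ n - 2 * 2^-1 ^+ (n + j.+1) =
      2^-1 ^+ (n + j) + (2 * 2^-1 ^+ n - 2 * 2^-1 ^+ (n + j)) :> R.
    by rewrite addnS exprS; field.
  have := l1leD (hD (n + j)%N) IH; apply: l1le_dom => k x.
  by rewrite addnS /seradd !sersubE addrA subrK.
have p0 n : 0 < 2^-1 ^+ n :> R by rewrite exprn_gt0 // invr_gt0.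
have cau n m : (n <= m)%N -> l1le (sersub (Y n) (Y m)) (2 * 2^-1 ^+ n).
  move=> nm; apply: l1le_subC; rewrite -(subnKC nm); apply: l1le_weak (tele _ _).
  by have := p0 (n + (m - n))%N; lra.
have /choice[y hy] : forall kx : int * X, exists L, forall n,
    cabs (Y n kx.1 kx.2 - L) <= 2 * (2 * 2^-1 ^+ n).
  move=> [k x]; apply: complex_cauchy_limit => [n|n m nm]; first by have := p0 n; lra.
  by have := l1le_cabs k x (cau n m nm); rewrite sersubE.
pose yy : ser := fun k x => y (k, x).
(* The pointwise rate, too weak to be summed over [s], is used only at a far index [m] where its
   total is at most [e]; the rate at [n] comes from [cau]. *)
have lim n : l1le (sersub (Y n) yy) (2 * 2^-1 ^+ n).
  move=> p s us; apply/ler_addgt0Pr => e e0.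
  have [m nm hm] := pow2_small ((size s)%:R * 4) n e0.
  have h1 : \sum_(k <- s) cabs (sersub (Y m) yy k (p k)) <= (size s)%:R * 4 * 2^-1 ^+ m.
    have -> : (size s)%:R * 4 * 2^-1 ^+ m = \sum_(k <- s) (2 * (2 * 2^-1 ^+ m)) :> R.
      by rewrite big_const_seq count_predT iter_addr_0 -[RHS]mulr_natl; ring.
    by apply: ler_sum => k _; rewrite sersubE; exact: (hy (k, p k)).
  have h2 := cau n m nm p s us.
  have : \sum_(k <- s) cabs (sersub (Y n) yy k (p k)) <=
      \sum_(k <- s) cabs (sersub (Y n) (Y m) k (p k)) +
      \sum_(k <- s) cabs (sersub (Y m) yy k (p k)).
    by rewrite -big_split; apply: ler_sum => k _; rewrite !sersubE cabs_tri.
  lra.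
exists yy; split=> //.
apply: (@in_l1I _ _ hne hcpt _ (l1norm (Y 0%N) + 2 * 2^-1 ^+ 0)).
  move=> k; apply: ccont_uniform_limit => e e0.
  have [m _ hm] := pow2_small 4 0 e0.
  exists (Y m k); first exact: in_l1_ccont.
  by move=> x; rewrite cabs_subC; have := hy (k, x) m; rewrite /yy /=; lra.
have := l1leD (l1le_l1norm hne hcpt (hY 0%N)) (l1le_subC (lim 0%N)).
by apply: l1le_dom => k x; rewrite /seradd sersubE addrC subrK.
Qed.

(* The square root of [1 - h] is [1 - y] for the fixed point [y] of the contraction
   [y |-> (h + y * y) / 2]. *)
Lemma one_sub_square h : in_l1 h -> serstar h = h -> l1le h (1 / 2) ->
  exists w, [/\ in_l1 w, sermul (serstar w) w = sersub (@ser1 R X) h &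
    fixsupp h -> fixsupp w].
Proof.
move=> ih sh nh.
pose step y := seradd (serscale 2^-1 h) (serscale 2^-1 (sermul y y)).
pose Y := fix Y n := if n is m.+1 then step (Y m) else @ser0 R X.
have cabs_half : cabs (2^-1 : R[i]) = 2^-1.
  by rewrite -[2^-1 : R[i]](_ : (2^-1)%:C = _) ?cabs_real ?invr_ge0 // fmorphV rmorph_nat.
have conj_half : (2^-1 : R[i])^*%C = 2^-1 by rewrite fmorphV rmorph_nat.
(* The ball of radius 1/2 is stable under [step], as [(1/2 + 1/4) / 2 <= 1/2]. *)
have hY n : in_l1 (Y n) /\ l1le (Y n) (1 / 2).
  elim: n => [|n [i1 i2]].
    have h0 : l1le (@ser0 R X) (1 / 2).
      move=> p s us; rewrite big1 => [|k _]; first by lra.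
      by rewrite /ser0 cabs0.
    by split=> //; apply: in_l1I h0 => // k; exact: ccont_cst.
  split; first by apply: in_l1_lin => //; exact: in_l1M.
  have hyy := l1leM sigma sigmai hne hcpt (fun k => in_l1_ccont k i1) i2 i2.
  have := l1leD (l1leZ 2^-1 nh) (l1leZ 2^-1 hyy).
  by apply: l1le_weak; rewrite cabs_half; lra.
have iY n : in_l1 (Y n) by case: (hY n).
have nY n : l1le (Y n) (1 / 2) by case: (hY n).
(* On that ball [y * y] has Lipschitz constant [1/2 + 1/2], and the factor 1/2 in [step] makes it a
   contraction. *)
have hD n : l1le (sersub (Y n.+1) (Y n)) (2^-1 ^+ n).
  elim: n => [|n IH].
    have := l1leD (nY 1%N) (nY 0%N); rewrite expr0 (_ : 1 / 2 + 1 / 2 = 1); last by field.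
    apply: l1le_dom => k x; rewrite sersubE /seradd {2 4}/Y /ser0 subr0 addr0; exact: lexx.
  have := l1leZ 2^-1 (l1le_mul_sub (iY n.+1) (iY n.+1) (iY n) (iY n) (nY n.+1) (nY n) IH IH).
  rewrite cabs_half => hq; have {hq} : l1le (serscale 2^-1
      (sersub (sermul (Y n.+1) (Y n.+1)) (sermul (Y n) (Y n)))) (2^-1 ^+ n.+1).
    by apply: l1le_weak hq; rewrite exprS; have : 0 <= 2^-1 ^+ n :> R;
      [rewrite exprn_ge0 // invr_ge0|lra].
  apply: l1le_dom => k x; rewrite le_eqVlt; apply/predU1P; left; congr cabs.
  rewrite /serscale !sersubE.
  by rewrite -/(Y n.+1) /= /step /seradd /serscale; ring.
have [y [iy ly]] := l1_complete iY hD.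
have [M hM] := in_l1_bound hne hcpt iy.
have M0 := l1le_ge0 hne hM.
(* Every identity for [y] is obtained coefficientwise, by showing that the iterates approach the
   other side geometrically. *)
have lim k x (P : R[i]) (C : R) :
    (forall n, cabs (P - Y n.+1 k x) <= C * 2^-1 ^+ n) -> y k x = P.
  move=> hP; apply/eqP; rewrite -subr_eq0; apply/eqP; apply: cabs_small => e e0.
  have [m _ hm] := pow2_small (C + 1) 0 e0.
  have := l1le_cabs k x (ly m.+1); rewrite sersubE exprS => h1.
  have := hP m; have := cabs_tri (Y m.+1 k x) (y k x) P.
  by rewrite (cabs_subC (y k x) (Y m.+1 k x)) (cabs_subC P); lra.
have fixp k x : y k x = 2^-1 * h k x + 2^-1 * sermul y y k x.
  apply: (lim _ _ _ (1 / 2 + M)) => n.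
  have := l1le_cabs k x (l1le_mul_sub (iY n) (iY n) iy iy (nY n) hM (ly n) (ly n)).
  rewrite sersubE.
  rewrite (_ : Y n.+1 k x = 2^-1 * h k x + 2^-1 * sermul (Y n) (Y n) k x) //.
  rewrite opprD addrACA subrr add0r -mulrBr cabsM cabs_half (cabs_subC (sermul y y k x)); lra.
have starY n : serstar (Y n) = Y n.
  elim: n => [|n IH].
    by apply: serP => k x; rewrite -[LHS]/((0 : R[i])^*%C) conjc0.
  rewrite -[Y n.+1]/(step (Y n)) /step serstar_lin sh.
  by rewrite (serstar_mul hne hcpt hK1 hK2 (iY n) (iY n)) IH conj_half.
have sy : serstar y = y.
  apply: serP => k x; symmetry; apply: (lim _ _ _ 1) => n.
  rewrite -{1}starY /Defs.serstar -rmorphB cabsJ cabs_subC -sersubE.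
  by have := l1le_cabs (- k) (iterz (- k) x) (ly n.+1); rewrite exprS; lra.
have i1 : in_l1 (@ser1 R X) by exact: in_l1_ser1.
exists (sersub (@ser1 R X) y); split.
- exact: in_l1B.
(* Since [y] is hermitian, the square is [1 - 2 y + y * y], and the fixed-point equation reads
   [y * y = 2 y - h]. *)
- rewrite {1}/sersub serstar_lin serstar1 sy rmorph1 rmorphN1 -/(sersub _ _).
  rewrite {1}/sersub (sermul_linl sigma sigmai hne hcpt _ _ i1 iy (in_l1B i1 iy)).
  rewrite sermul1l {2}/sersub (sermul_linr sigma sigmai hne hcpt _ _ i1 iy iy) sermul1r.
  apply: serP => k x; rewrite /sersub /seradd /serscale.
  by rewrite [in X in _ + X](fixp k x) [in X in X + _](fixp k x); field.
- move=> fh.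
  have fY n : fixsupp (Y n).
    elim: n => [|n IH]; first by move=> k x; rewrite -[Y 0%N k x]/(0 : R[i]) eqxx.
    by apply: fixsupp_lin => //; exact: fixsuppM.
  apply: fixsupp_lin; first exact: fixsupp1.
  move=> k x; apply: contraNP => kx; apply/eqP; apply: (lim _ _ _ 0) => n.
  rewrite mul0r (_ : Y n.+1 k x = 0) ?subrr ?cabs0 //.
  by have [//|/fY] := eqVneq (Y n.+1 k x) 0.
Qed.

End SquareRoot.

(** * States of the commutant, positive functionals and positive projections *)

Section PositiveProjections.
Variables (R : realType) (X : topologicalType) (sigma sigmai : X -> X).
Hypotheses (hne : [set: X] !=set0) (hcpt : compact [set: X]) (hT2 : hausdorff_space X).
Hypotheses (hcs : continuous sigma) (hcsi : continuous sigmai).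
Hypotheses (hK1 : cancel sigma sigmai) (hK2 : cancel sigmai sigma).
Local Notation iterz := (iterz sigma sigmai).
Local Notation sermul := (sermul sigma sigmai).
Local Notation serstar := (serstar sigma sigmai).
Local Notation ser := (ser R X).
Local Notation fixsupp := (@fixsupp R X sigma sigmai).
Implicit Types (a b l : ser) (f g : X -> R[i]) (k m n : int) (x : X) (c d : R[i]).

(** For [m != 0], read [l k x] as the coefficients of a trigonometric series in [z]: this integrates
    it over the circle against the density [1 + Re(conj(c) z^m)], nonnegative when [|c| = 1]. *)
Definition test_state x m c l : R[i] := l 0 x + 2^-1 * (c * l m x + c^*%C * l (- m) x).

(* On a square [a^* a] the value is [1/2 sum_k |a_{-k}(x) + c a_{m-k}(x)|^2]. *)
Lemma is_state_test x m c : m != 0 -> c * c^*%C = 1 ->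
  is_state sigma sigmai (test_state x m c).
Proof.
move=> m0 cc; split; last split.
- by move=> a b e d _ _; rewrite /test_state /seradd /serscale; ring.
- move=> a /(comm1P hcpt hT2 hK1 hK2)[ha fa].
  have [M hM] := in_l1_bound hne hcpt ha.
  rewrite /test_state !(sermul_star_fixsupp hK1 hK2) //.
  pose u k := a k x; pose F (i j k : int) : R[i] := (u (i - k))^*%C * u (j - k).
  have hF i j : sums_le (F i j) (M * M) by exact: star_sums.
  (* Translation invariance reduces the four sums in the expansion of [|w k|^2] to the coefficients
     of [a^* a] at 0, [m] and [-m]. *)
  have hS i j : zsumC (F (i + m) (j + m)) = zsumC (F i j).
    rewrite -(zsumC_reindex (g := fun k => k + m) (h := fun k => k - m) _ _ (hF _ _)).
    + congr zsumC; apply/funext => k.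
      have e p : p + m - (k + m) = p - k :> int by ring.
      by rewrite /F !e.
    + by move=> k; rewrite addrK.
    + by move=> k; rewrite subrK.
  have Smm : zsumC (F m m) = zsumC (F 0 0) by rewrite -(hS 0 0) !add0r.
  have Sm0 : zsumC (F m 0) = zsumC (F 0 (- m)) by rewrite -(hS 0 (- m)) add0r addNr.
  have E0 n : zsumC (fun k => (a (- k) x)^*%C * a (n - k) x) = zsumC (F 0 n).
    by congr zsumC; apply/funext => k; rewrite /F /u sub0r.
  pose w k := u (- k) + c * u (m - k).
  have hG := sums_leD (hF 0 0) (sums_leD (sums_leZ c (hF 0 m))
      (sums_leD (sums_leZ c^*%C (hF m 0)) (hF m m))).
  have Gw : (fun k => F 0 0 k + (c * F 0 m k + (c^*%C * F m 0 k + F m m k))) =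
      (fun k => w k * (w k)^*%C).
    apply/funext => k; rewrite /F /w !sub0r rmorphD rmorphM /=.
    set p := u (- k); set q := u (m - k).
    rewrite -[q^*%C * q]mul1r -cc; ring.
  have : 0 <= zsumC (fun k => w k * (w k)^*%C).
    rewrite -Gw; apply: zsumC_ge0 hG _ => k; rewrite (congr1 (fun G : int -> R[i] => G k) Gw).
    by rewrite conjcE lecR sqr_ge0.
  rewrite -Gw (zsumCD (hF 0 0) (sums_leD (sums_leZ c (hF 0 m))
      (sums_leD (sums_leZ c^*%C (hF m 0)) (hF m m)))).
  rewrite (zsumCD (sums_leZ c (hF 0 m)) (sums_leD (sums_leZ c^*%C (hF m 0)) (hF m m))).
  rewrite (zsumCD (sums_leZ c^*%C (hF m 0)) (hF m m)) !(zsumCZ _ (hF _ _)).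
  rewrite Smm Sm0 !E0 => h.
  rewrite (_ : _ + _ = 2^-1 * (zsumC (F 0 0) + (c * zsumC (F 0 m) +
     (c^*%C * zsumC (F 0 (- m)) + zsumC (F 0 0))))); last by field.
  by rewrite mulr_ge0 // invr_ge0.
- rewrite /test_state /ser1 /emb eqxx oppr_eq0 (negbTE m0); ring.
Qed.

(** Polarization: the values at [c = 1] and [c = -1] give the coefficient at 0, and together with
    [c = i] the coefficient at [m]. *)
Lemma test_state_sep x a b :
  (forall m c, m != 0 -> c * c^*%C = 1 -> test_state x m c a = test_state x m c b) ->
  forall k, a k x = b k x.
Proof.
move=> h.
have hi : 'i%C * 'i%C = -1 :> R[i] by rewrite -expr2 sqr_i.
have rec0 m l : l 0 x = 2^-1 * (test_state x m 1 l + test_state x m (-1) l).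
  by rewrite /test_state !rmorphN !rmorph1; field.
have rec m l : l m x = 2^-1 * (test_state x m 1 l - test_state x m (-1) l) -
   'i%C * (test_state x m 'i%C l - 2^-1 * (test_state x m 1 l + test_state x m (-1) l)).
  rewrite /test_state !rmorphN !rmorph1 (_ : ('i%C : R[i])^*%C = - 'i%C); last by simpc.
  rewrite [RHS](_ : _ = 2^-1 * (l m x + l (- m) x) -
    ('i%C * 'i%C) * 2^-1 * (l m x - l (- m) x)); last by field.
  by rewrite hi; field.
have u1 : 1 * (1 : R[i])^*%C = 1 by rewrite rmorph1 mulr1.
have uN1 : -1 * (-1 : R[i])^*%C = 1 by rewrite rmorphN rmorph1 mulrNN mulr1.
have ui : 'i%C * ('i%C : R[i])^*%C = 1.
  by rewrite (_ : ('i%C : R[i])^*%C = - 'i%C) ?mulrN ?hi ?opprK //; simpc.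
move=> k; have [->|k0] := eqVneq k 0.
  by rewrite (rec0 1 a) (rec0 1 b) !h.
by rewrite (rec k a) (rec k b) !h.
Qed.

(* Positive normalized functionals on [l^1] ([P := False]) or on the commutant
   of [C(X)] ([P := True]). *)
Definition dom (P : Prop) l : Prop := in_l1 l /\ (P -> fixsupp l).

Definition posfun (P : Prop) (psi : ser -> R[i]) : Prop :=
  [/\ forall a b c d, dom P a -> dom P b ->
        psi (seradd (serscale c a) (serscale d b)) = c * psi a + d * psi b,
      forall a, dom P a -> 0 <= psi (sermul (serstar a) a) &
      psi (@ser1 R X) = 1].

Lemma posfun_state phi : is_state sigma sigmai phi -> posfun True phi.
Proof.
move=> [lin [pos one]].
have D a : dom True a -> comm1 sigma sigmai a.
  by move=> [ha /(_ I) fa]; apply/(comm1P hcpt hT2 hK1 hK2).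
by split=> // [a b c d /D ha /D hb|a /D ha]; [exact: lin|exact: pos].
Qed.

(** Automatic boundedness: for real [t] with [|t| = 1/(2e)] the element [1 - t r] is a square inside
    the domain, so [psi] is nonnegative on it; both signs of [t] bound [psi r]. *)
Lemma posfun_small P psi r (e : R) : posfun P psi -> dom P r -> serstar r = r ->
  0 < e -> l1le r e -> cabs (psi r) <= 2 * e.
Proof.
move=> [lin pos one] [ir fr] sr e0 re.
have d1 : dom P (@ser1 R X) by split=> [|_]; [exact: in_l1_ser1|exact: fixsupp1].
have key (t : R) : `|t| = (2 * e)^-1 -> 0 <= 1 - t%:C * psi r.
  (* The dummy summand writes [t r] as a two-term combination, the form in which linearity of [psi]
     is given. *)
  move=> ht; pose h := seradd (serscale t%:C r) (serscale 0 r).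
  have hE k x : h k x = t%:C * r k x by rewrite /h /seradd /serscale mul0r addr0.
  have ih : in_l1 h by exact: in_l1_lin.
  have sh : serstar h = h by rewrite /h serstar_lin sr conjc0 conjc_real.
  have lh : l1le h (1 / 2).
    have := l1leZ t%:C re; have -> : cabs t%:C * e = 1 / 2 :> R.
      have -> : cabs t%:C = `|t| by rewrite /cabs /= expr0n /= addr0 sqrtr_sqr.
      by rewrite ht invfM -mulrA mulVf ?gt_eqF // mulr1 mul1r.
    by apply: l1le_dom => k x; rewrite hE.
  have [w [iw ww fw]] := one_sub_square hne hcpt hcs hcsi hK1 hK2 ih sh lh.
  have dh : dom P h by split=> // p; apply: fixsupp_lin; exact: fr.
  have /pos : dom P w by split=> // p; apply/fw; case: dh => _; apply.
  rewrite ww /sersub lin // one /h lin // mul0r addr0 mulr1 mulN1r; exact.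
have e20 : 0 < 2 * e by lra.
have := key (2 * e)^-1; have := key (- (2 * e)^-1).
rewrite normrN !ger0_norm ?invr_ge0 ?(ltW e20) // => /(_ erefl) + /(_ erefl).
case: (psi r) => p q; rewrite rmorphN mulNr opprK !complex_ge0 /= !mul0r !subr0 !addr0.
set s := (2 * e)^-1 => /andP[/eqP h1 h2] /andP[_ h3].
have s0 : 0 < s by rewrite invr_gt0.
have q0 : q = 0.
  move: h1; rewrite add0r => /eqP; rewrite mulf_eq0 (gt_eqF s0) => /eqP //.
rewrite q0 /cabs /= expr0n /= addr0 sqrtr_sqr.
have -> : 2 * e = s^-1 by rewrite /s invrK.
rewrite -(ler_pM2l s0) mulfV ?gt_eqF // -[X in X * _](gtr0_norm s0) -normrM ler_norml.
by apply/andP; split; lra.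
Qed.

(** The degenerate case of Cauchy-Schwarz: expanding the square of [b + c a] leaves
    [psi(b^* b) + c q + conj(c) r >= 0] for all complex [c], which forces [q = r = 0]. *)
Lemma posfun_null_mul psi a b : posfun False psi -> in_l1 a -> in_l1 b ->
  psi (sermul (serstar a) a) = 0 ->
  psi (sermul (serstar b) a) = 0 /\ psi (sermul (serstar a) b) = 0.
Proof.
move=> [lin pos _] ia ib aa0.
have {}lin u v c d : in_l1 u -> in_l1 v ->
    psi (seradd (serscale c u) (serscale d v)) = c * psi u + d * psi v.
  by move=> iu iv; apply: lin; split.
have isa := in_l1_star hne hcpt hcs hcsi ia.
have isb := in_l1_star hne hcpt hcs hcsi ib.
have im (u v : ser) : in_l1 u -> in_l1 v -> in_l1 (sermul u v) by exact: in_l1M.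
set q := psi (sermul (serstar b) a); set r := psi (sermul (serstar a) b).
have key c : 0 <= psi (sermul (serstar b) b) + (c * q + c^*%C * r).
  have iab : in_l1 (seradd (serscale 1 b) (serscale c a)) by exact: in_l1_lin.
  have /pos : dom False (seradd (serscale 1 b) (serscale c a)) by split; [exact: iab|case].
  rewrite serstar_lin (sermul_linl sigma sigmai hne hcpt _ _ isb isa iab).
  rewrite (lin _ _ _ _ (im _ _ isb iab) (im _ _ isa iab)).
  rewrite (sermul_linr sigma sigmai hne hcpt _ _ ib ia isb).
  rewrite (sermul_linr sigma sigmai hne hcpt _ _ ib ia isa).
  rewrite (lin _ _ _ _ (im _ _ isb ib) (im _ _ isb ia)).
  rewrite (lin _ _ _ _ (im _ _ isa ib) (im _ _ isa ia)).
  rewrite aa0 -/q -/r rmorph1; congr (0 <= _); ring.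
(* An affine function of a real variable that stays nonnegative has slope zero; it is applied below
   to real and to purely imaginary [c]. *)
have key2 z : (forall t : R, 0 <= psi (sermul (serstar b) b) + t%:C * z) -> z = 0.
  case: (psi _) z {key} => p0 p1 [z0 z1] h.
  have h0 := h 0; have h1 := h 1; move: h0 h1.
  rewrite !complex_ge0 /= !mul0r !mul1r !subr0 !addr0 => /andP[/eqP e1 e2] /andP[/eqP e3 e4].
  have z10 : z1 = 0 by rewrite -e3 e1; ring.
  suff z00 : z0 = 0 by rewrite z00 z10.
  apply/eqP; apply: contraT => nz.
  (* At this argument the real part would be [-1]. *)
  have := h (- (p0 + 1) / z0); rewrite complex_ge0 /= => /andP[_].
  by rewrite mul0r subr0 divfK //; lra.
have s1 : q + r = 0.
  by apply: key2 => t; have := key t%:C; rewrite conjc_real -mulrDr.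
have s2 : 'i%C * (q - r) = 0.
  apply: key2 => t; have := key (t%:C * 'i%C).
  rewrite (_ : (t%:C * 'i%C : R[i])^*%C = - (t%:C * 'i%C)); last by simpc.
  by congr (0 <= _); ring.
have {}s2 : q - r = 0.
  by apply/eqP; move/eqP: s2; rewrite mulf_eq0 => /orP[/eqP[/eqP]|//]; rewrite oner_eq0.
have e : q = 2^-1 * (q + r + (q - r)) by field.
have e' : r = 2^-1 * (q + r - (q - r)) by field.
by split; [rewrite e s1 s2 addr0 mulr0|rewrite e' s1 s2 subr0 mulr0].
Qed.

Definition mono f k : ser := fun n x => if n == k then f x else 0.

Lemma in_l1_mono f k : ccont f -> in_l1 (mono f k).
Proof.
move=> cf; have [x _ hx] := supnorm_attained hne hcpt cf.
apply: (@in_l1I _ _ hne hcpt _ (cabs (f x))) => [n|p s us].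
  by rewrite /mono; case: (n == k) => //; exact: ccont_cst.
have h n : n \notin [:: k] -> mono f k n (p n) = 0 by rewrite inE /mono => /negbTE ->.
apply: le_trans (sums_le_supp h us) _.
by rewrite /= big_seq1 /mono eqxx.
Qed.

Lemma fixsupp_mono f k : (forall x, f x != 0 -> iterz k x = x) -> fixsupp (mono f k).
Proof. by move=> h n x; rewrite /mono; have [->|_] := eqVneq n k; [exact: h|rewrite eqxx]. Qed.

(** * Module property and supports for a positive projection *)

Section Projection.
Variable E : ser -> ser.
Hypotheses (hE : is_proj sigma sigmai E) (hp : is_positive sigma sigmai E).

Lemma proj_l1 l : in_l1 l -> in_l1 (E l).
Proof. by case: hE => h _; exact: h. Qed.

Lemma proj_lin a b c d : in_l1 a -> in_l1 b ->
  E (seradd (serscale c a) (serscale d b)) = seradd (serscale c (E a)) (serscale d (E b)).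
Proof. by case: hE => _ [h _]; exact: h. Qed.

Lemma proj_fixsupp l : in_l1 l -> fixsupp (E l).
Proof.
by case: hE => _ [_ [_ [h _]]] /h/(comm1P hcpt hT2 hK1 hK2)[].
Qed.

Lemma proj_id l : in_l1 l -> fixsupp l -> E l = l.
Proof.
move=> il fl; case: hE => _ [_ [idem [_ surj]]].
have /surj[l' [il' <-]] : comm1 sigma sigmai l by apply/(comm1P hcpt hT2 hK1 hK2).
exact: idem.
Qed.

(** Makes Cauchy-Schwarz and automatic boundedness available for [phi] composed with [E]; a square
    lies in the cone as a one-term sum. *)
Lemma posfun_proj phi : is_state sigma sigmai phi -> posfun False (fun l => phi (E l)).
Proof.
move=> hphi; have [lin _ one] := posfun_state hphi.
have DE l : in_l1 l -> dom True (E l).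
  by move=> il; split=> [|_]; [exact: proj_l1|exact: proj_fixsupp].
split=> [a b c d [ia _] [ib _]|a [ia _]|].
- by rewrite proj_lin // lin //; exact: DE.
- apply: hp => //; exists [:: a]; split=> [b|]; first by rewrite inE => /eqP ->.
  by apply: serP => k x; rewrite /= /seradd /ser0 addr0.
- by rewrite proj_id //; [exact: in_l1_ser1|exact: fixsupp1].
Qed.

(* Cauchy-Schwarz: [g - g x] is a null vector of the state composed with [E]. *)
Lemma proj_module_state g b x m c : ccont g -> in_l1 b -> m != 0 -> c * c^*%C = 1 ->
  test_state x m c (E (sermul b (emb g))) = g x * test_state x m c (E b) /\
  test_state x m c (E (sermul (emb g) b)) = g x * test_state x m c (E b).
Proof.
move=> cg ib m0 cc.
have hs := is_state_test x m0 cc; have hpsi := posfun_proj hs.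
set psi := fun l => _ in hpsi.
pose h y := g y - g x.
have ch : ccont h by apply: ccontD => //; exact: ccont_cst.
have starE f : serstar (emb f) = emb (fun y => (f y)^*%C).
  apply: serP => n y; rewrite /Defs.serstar /emb oppr_eq0.
  by have [->|] := eqVneq n 0; rewrite ?oppr0 // conjc0.
have fe f : fixsupp (emb f).
  by move=> k y; rewrite /emb; have [->|] := eqVneq k 0; rewrite ?eqxx.
(* The square is the function [|f|^2], which [E] fixes; the test state evaluates it at [x], as
   [m != 0]. *)
have null f : ccont f -> f x = 0 -> psi (sermul (serstar (emb f)) (emb f)) = 0.
  move=> cf fx; have ie := in_l1_emb hne hcpt cf.
  rewrite /psi proj_id.
  - rewrite /test_state starE !sermul_embl /emb fx eqxx oppr_eq0 (negbTE m0) !mulr0.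
    by rewrite addr0 mulr0 addr0.
  - exact: in_l1M hne hcpt hcs hcsi _ _ (in_l1_star hne hcpt hcs hcsi ie) ie.
  - exact: fixsuppM hK1 hK2 _ _ (fixsupp_star hK1 hK2 (fe f)) (fe f).
have hx0 : h x = 0 by rewrite /h subrr.
have ih := in_l1_emb hne hcpt ch.
have cj0 : (h x)^*%C = 0 by rewrite hx0 conjc0.
have cjh : ccont (fun y => (h y)^*%C) by exact: ccont_conj.
(* Right multiplication uses the null vector [emb h]; left multiplication uses its conjugate, whose
   star is [emb h]. *)
have [r1 _] := posfun_null_mul hpsi ih (in_l1_star hne hcpt hcs hcsi ib) (null _ ch hx0).
have [_ r2] := posfun_null_mul hpsi (in_l1_emb hne hcpt cjh) ib
  (null _ cjh cj0).
rewrite (serstarK hK1 hK2) in r1.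
have [lin _ _] := hpsi.
have eR : sermul b (emb g) = seradd (serscale 1 (sermul b (emb h))) (serscale (g x) b).
  apply: serP => n y; rewrite /seradd /serscale !sermul_embr /h; ring.
have eL : sermul (emb g) b = seradd (serscale 1 (sermul (serstar (emb (fun y => (h y)^*%C))) b))
    (serscale (g x) b).
  apply: serP => n y; rewrite starE /seradd /serscale !sermul_embl /h conjcK; ring.
have db : dom False b := conj ib (fun F : False => False_ind _ F).
have dR : dom False (sermul b (emb h)).
  by split; [exact: in_l1M hne hcpt hcs hcsi _ _ ib ih|case].
have dL : dom False (sermul (serstar (emb (fun y => (h y)^*%C))) b).
  split; last by case.
  have isj := in_l1_star hne hcpt hcs hcsi (in_l1_emb hne hcpt cjh).
  exact: in_l1M hne hcpt hcs hcsi _ _ isj ib.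
split.
  by rewrite -[LHS]/(psi _) eR (lin _ _ _ _ dR db) r1 mulr0 add0r.
by rewrite -[LHS]/(psi _) eL (lin _ _ _ _ dL db) r2 mulr0 add0r.
Qed.

Lemma test_state_scale g x m c l :
  test_state x m c (fun n y => g y * l n y) = g x * test_state x m c l.
Proof. by rewrite /test_state; ring. Qed.

(** The factor is [g x] without a twist, just as in [proj_mull]; the comparison of the two restricts
    the support of [E] on monomials. *)
Lemma proj_mulr g b n x : ccont g -> in_l1 b ->
  E (sermul b (emb g)) n x = g x * E b n x.
Proof.
move=> cg ib; apply: (@test_state_sep x _ (fun n y => g y * E b n y)) => m c m0 cc.
by rewrite test_state_scale; case: (proj_module_state x cg ib m0 cc).
Qed.

Lemma proj_mull g b n x : ccont g -> in_l1 b ->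
  E (sermul (emb g) b) n x = g x * E b n x.
Proof.
move=> cg ib; apply: (@test_state_sep x _ (fun n y => g y * E b n y)) => m c m0 cc.
by rewrite test_state_scale; case: (proj_module_state x cg ib m0 cc).
Qed.

Lemma sermul_emb_mono g f k : sermul (emb g) (mono f k) = mono (fun x => g x * f x) k.
Proof.
by apply: serP => n x; rewrite sermul_embl /mono; case: (n == k); rewrite ?mulr0.
Qed.

(** Moving [g] across [f delta^k] turns it into [g o sigma^{-k}], while [E] extracts the value at
    [x] from either side. With [g x = 1] and [g] zero at [sigma^{-k} x], every coefficient [n]
    vanishes at [x]. *)
Lemma proj_mono_fix f k n x : ccont f -> E (mono f k) n x != 0 -> iterz k x = x.
Proof.
move=> cf; apply: contraNP => kx.
have im := in_l1_mono k cf.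
have cx : closed [set iterz (- k) x].
  by apply: accessible_closed_set1; exact: hausdorff_accessible.
have [|g [cg gx g0]] := @ccont_separation R _ hcpt hT2 _ x cx.
  by move=> /= e; apply: kx; rewrite [in LHS]e iterzK.
have cgk : ccont (fun y => g (iterz (- k) y)).
  by apply: (ccont_comp (f := g)) => //; exact: continuous_iterz.
have e : sermul (mono f k) (emb g) = sermul (emb (fun y => g (iterz (- k) y))) (mono f k).
  apply: serP => m y; rewrite sermul_embr sermul_embl /mono.
  by have [->|_] := eqVneq m k; rewrite ?mul0r ?mulr0 // mulrC.
have := proj_mulr n x cg im; rewrite e (proj_mull _ _ cgk im) gx mul1r g0 // mul0r.
by move=> <-.
Qed.

Lemma proj_mono_interior f k n x : ccont f -> E (mono f k) n x != 0 ->
  interior (Fixk sigma sigmai k) x.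
Proof.
move=> cf; apply: ccont_neq0_interior.
  by apply: in_l1_ccont; apply: proj_l1; exact: in_l1_mono.
by move=> y; exact: proj_mono_fix.
Qed.

(* The coefficient [E(delta^k)_k] is the characteristic function of the interior. *)
Lemma proj_interior_closed k : closed (interior (Fixk sigma sigmai k)).
Proof.
have c1 : ccont (fun _ : X => 1 : R[i]) by exact: ccont_cst.
have im := in_l1_mono k c1.
pose h := E (mono (fun=> 1) k) k.
have ch : ccont h by apply: in_l1_ccont; exact: proj_l1.
have h1 x : interior (Fixk sigma sigmai k) x -> h x = 1.
  move=> kx.
  (* A bump function [g] at [x] supported in the interior: [g delta^k] lies in the commutant, so [E]
     fixes it and [h x = g x * h x = g x = 1]. *)
  have [||g [cg gx g0]] := @ccont_separation R _ hcpt hT2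
      (~` interior (Fixk sigma sigmai k)) x.
  - by apply: open_closedC; exact: open_interior.
  - by apply.
  have gfix y : g y != 0 -> iterz k y = y.
    move=> gy; suff /interior_subset : interior (Fixk sigma sigmai k) y by [].
    by apply: contrapT => /g0 gy0; rewrite gy0 eqxx in gy.
  have := proj_mull k x cg im; rewrite sermul_emb_mono gx mul1r => e.
  rewrite /h -e proj_id.
  - by rewrite /mono eqxx gx mulr1.
  - by apply: in_l1_mono; apply: ccontM.
  - by apply: fixsupp_mono => y; rewrite mulr1; exact: gfix.
rewrite -[interior _]setCK; apply: open_closedC; rewrite openE => x kx.
have hx : h x = 0.
  by apply/eqP; apply: contraT => /(proj_mono_interior c1).
(* Near a zero of [h] the value 1 is excluded, so no nearby point belongs to the interior. *)
have : \forall y \near x, cabs (h x - h y) <= 1 / 2 by move/ccontP: ch; apply; lra.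
apply: filterS => y; rewrite hx sub0r cabsN => hy /h1 hy1.
by move: hy; rewrite hy1 cabs1; lra.
Qed.

End Projection.

End PositiveProjections.

(** * Multiplication by the characteristic functions, the interiors being closed *)

Section CanonicalProjection.
Variables (R : realType) (X : topologicalType) (sigma sigmai : X -> X).
Hypotheses (hne : [set: X] !=set0) (hcpt : compact [set: X]) (hT2 : hausdorff_space X).
Hypotheses (hcs : continuous sigma) (hcsi : continuous sigmai).
Hypotheses (hK1 : cancel sigma sigmai) (hK2 : cancel sigmai sigma).
Hypothesis hcl : forall k : int, closed (interior (Fixk sigma sigmai k)).
Local Notation iterz := (iterz sigma sigmai).
Local Notation sermul := (sermul sigma sigmai).
Local Notation serstar := (serstar sigma sigmai).
Local Notation ser := (ser R X).
Local Notation fixsupp := (@fixsupp R X sigma sigmai).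
Local Notation K k x := (interior (Fixk sigma sigmai k) x).
Local Notation chi := (chi R sigma sigmai).
Implicit Types (a b l : ser) (f g : X -> R[i]) (k m n : int) (x : X) (c d : R[i]).

Lemma chi1 k x : K k x -> chi k x = 1.
Proof. by move=> h; rewrite /Defs.chi (asboolT h). Qed.

Lemma chi0 k x : ~ K k x -> chi k x = 0.
Proof. by move=> h; rewrite /Defs.chi (asboolF h). Qed.

(** The interiors are clopen by [hcl]; continuity of [chi] and of the class sizes below rests on
    this. *)
Lemma interior_Fixk_locally_constant k x :
  \forall y \near x, `[< K k y >] = `[< K k x >].
Proof.
have [h|h] := pselect (K k x).
  have := open_interior (Fixk sigma sigmai k); rewrite openE => /(_ x h).
  by apply: filterS => y hy; rewrite !asboolT.
have := closed_openC (@hcl k); rewrite openE => /(_ x h).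
by apply: filterS => y hy; rewrite !asboolF.
Qed.

Lemma ccont_locally_constant f : (forall x, \forall y \near x, f y = f x) -> ccont f.
Proof.
move=> h; apply/ccontP => x e e0; apply: filterS (h x) => y ->.
by rewrite subrr cabs0 ltW.
Qed.

Lemma ccont_chi k : ccont (chi k).
Proof.
apply: ccont_locally_constant => x.
by apply: filterS (interior_Fixk_locally_constant k x) => y; rewrite /Defs.chi => ->.
Qed.

Lemma chi_eq_iff j k x y : (K j x <-> K k y) -> chi j x = chi k y.
Proof. by move=> h; rewrite /Defs.chi (asbool_equiv_eq h). Qed.

Lemma chi_iterz j k x : chi k (iterz j x) = chi k x.
Proof.
apply: chi_eq_iff; split; first exact: interior_Fixk_iterz.
by move=> h; apply: (@interior_Fixk_iterz _ _ _ hcs hcsi hK1 hK2 (- j)); rewrite iterzNK.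
Qed.

Lemma chiN k x : chi (- k) x = chi k x.
Proof.
apply: chi_eq_iff; split; last exact: interior_FixkN.
by move=> /(interior_FixkN hK1 hK2); rewrite opprK.
Qed.

(** At fixed [x], [chi] is the indicator of a subgroup of the integers, hence invariant under
    translation by its elements. *)
Lemma chi_addl k n x : K k x -> chi (k + n) x = chi n x.
Proof.
move=> h; apply: chi_eq_iff; split; last exact: interior_FixkD.
have hN := interior_FixkN hK1 hK2 h.
by move=> /(interior_FixkD hK1 hK2 hN); rewrite addKr.
Qed.

Definition chimul l : ser := fun k x => chi k x * l k x.

Lemma cabs_chi k x : cabs (chi k x) <= 1.
Proof.
have [h|h] := pselect (K k x); first by rewrite chi1 // cabs1.
by rewrite chi0 // cabs0.
Qed.

Lemma l1le_chimul l (M : R) : l1le l M -> l1le (chimul l) M.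
Proof.
by apply: l1le_dom => k x; rewrite cabsM ler_piMl ?cabs_ge0 // cabs_chi.
Qed.

Lemma in_l1_chimul l : in_l1 l -> in_l1 (chimul l).
Proof.
move=> il; have [M hM] := in_l1_bound hne hcpt il.
apply: in_l1I (l1le_chimul hM) => // k.
by apply: ccontM; [exact: ccont_chi|exact: in_l1_ccont].
Qed.

Lemma fixsupp_chimul l : fixsupp (chimul l).
Proof.
move=> k x; rewrite /chimul; have [/interior_subset //|h] := pselect (K k x).
by rewrite chi0 // mul0r eqxx.
Qed.

Lemma chimul_id l : in_l1 l -> fixsupp l -> chimul l = l.
Proof.
move=> il fl; apply: serP => k x; rewrite /chimul.
have [->|h] := eqVneq (l k x) 0; first by rewrite mulr0.
by rewrite chi1 ?mul1r //; apply: fixsupp_interior h => //; exact: in_l1_ccont.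
Qed.

Lemma chimul_lin c d a b :
  chimul (seradd (serscale c a) (serscale d b)) =
  seradd (serscale c (chimul a)) (serscale d (chimul b)).
Proof. by apply: serP => k x; rewrite /chimul /seradd /serscale; ring. Qed.

Lemma chimul_sub a b : chimul (sersub a b) = sersub (chimul a) (chimul b).
Proof. exact: chimul_lin. Qed.

Lemma conjc_chi k x : (chi k x)^*%C = chi k x.
Proof. by rewrite /Defs.chi rmorph_nat. Qed.

Lemma chimul_star l : chimul (serstar l) = serstar (chimul l).
Proof.
apply: serP => k x; rewrite /chimul /Defs.serstar rmorphM /= conjc_chi.
by rewrite chi_iterz chiN.
Qed.

Lemma is_proj_chimul : is_proj sigma sigmai chimul.
Proof.
have cE l : in_l1 l -> comm1 sigma sigmai (chimul l).
  move=> il; apply/(comm1P hcpt hT2 hK1 hK2).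
  by split; [exact: in_l1_chimul|exact: fixsupp_chimul].
split; first exact: in_l1_chimul.
split; first by move=> a b c d _ _; exact: chimul_lin.
split=> [l il|]; first by apply: chimul_id; [exact: in_l1_chimul|exact: fixsupp_chimul].
split=> // l /(comm1P hcpt hT2 hK1 hK2)[il fl]; exists l; split=> //.
exact: chimul_id.
Qed.

Definition trunc (s : seq int) l : ser := fun k x => if k \in s then l k x else 0.

Lemma l1le_trunc s l (M : R) : l1le l M -> l1le (trunc s l) M.
Proof.
by apply: l1le_dom => k x; rewrite /trunc; case: ifP; rewrite ?cabs0 ?cabs_ge0.
Qed.

Lemma in_l1_trunc s l : in_l1 l -> in_l1 (trunc s l).
Proof.
move=> il; have [M hM] := in_l1_bound hne hcpt il.
apply: in_l1I (l1le_trunc s hM) => // k; rewrite /trunc; case: (k \in s).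
  exact: in_l1_ccont.
exact: ccont_cst.
Qed.

Lemma trunc_star s l : (forall k, (- k \in s) = (k \in s)) ->
  serstar (trunc s l) = trunc s (serstar l).
Proof.
move=> hs; apply: serP => k x; rewrite /trunc /Defs.serstar hs.
by case: ifP; rewrite ?conjc0.
Qed.

(** The list is symmetrized so that truncation commutes with the involution and remainders of
    hermitian series stay hermitian, as [posfun_small] requires. *)
Lemma l1_tail l (e : R) : in_l1 l -> 0 < e -> exists s : seq int,
  [/\ uniq s, forall k, (- k \in s) = (k \in s) & l1le (sersub l (trunc s l)) e].
Proof.
move=> il e0; have [M hM] := in_l1_bound hne hcpt il.
have [p hp] := max_points hne hcpt (fun k => in_l1_ccont k il).
have [s0 hs0] := sums_le_tail (hM p) e0.
pose s := undup (s0 ++ map -%R s0).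
have ms k : (k \in s) = (k \in s0) || (- k \in s0).
  rewrite mem_undup mem_cat; congr orb; apply/mapP/idP => [[j js ->]|ks].
    by rewrite opprK.
  by exists (- k); rewrite ?opprK.
exists s; split=> [|k|q t ut]; first exact: undup_uniq.
  by rewrite !ms opprK orbC.
rewrite (bigID (mem s)) /= big1 ?add0r => [|k ks]; last first.
  by rewrite sersubE /trunc ks subrr cabs0.
rewrite -big_filter; apply: le_trans (hs0 _ (filter_uniq _ ut) _); last first.
  move=> k; rewrite mem_filter => /andP[ks _]; move: (ks : k \notin s).
  by rewrite ms negb_or => /andP[].
rewrite !big_filter; apply: ler_sum => k ks.
by rewrite sersubE /trunc (negbTE (ks : k \notin s)) subr0; case: (hp k).
Qed.

(** * The formula for an arbitrary positive projection *)

Section Formula.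
Variable E : ser -> ser.
Hypotheses (hE : is_proj sigma sigmai E) (hp : is_positive sigma sigmai E).

(** [chi_k f delta^k] is fixed by [E]. By the module property it also equals [chi_k E(f delta^k)],
    where [chi_k] acts trivially since the support lies in the interior. *)
Lemma proj_mono f k : ccont f -> E (mono f k) = chimul (mono f k).
Proof.
move=> cf; have im := in_l1_mono hne hcpt k cf.
have cchi := ccont_chi k.
have e : chimul (mono f k) = mono (fun y => chi k y * f y) k.
  apply: serP => n x; rewrite /chimul /mono.
  by have [->|_] := eqVneq n k; rewrite ?mulr0.
have Ee : E (mono (fun y => chi k y * f y) k) = mono (fun y => chi k y * f y) k.
  rewrite -e; apply: (proj_id hcpt hT2 hK1 hK2 hE) => //.
    exact: in_l1_chimul.
  exact: fixsupp_chimul.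
rewrite e -[in RHS]Ee -(sermul_emb_mono sigma sigmai).
apply: serP => n x; rewrite (proj_mull hne hcpt hT2 hcs hcsi hK1 hK2 hE hp) //.
have [->|h] := eqVneq (E (mono f k) n x) 0; first by rewrite mulr0.
rewrite chi1 ?mul1r //.
exact: (proj_mono_interior hne hcpt hT2 hcs hcsi hK1 hK2 hE hp cf h).
Qed.

Lemma proj_trunc s l : uniq s -> in_l1 l -> E (trunc s l) = chimul (trunc s l).
Proof.
move=> + il; elim: s => [_|k s IH /= /andP[ks us]].
  have f0 : fixsupp (trunc [::] l) by move=> k x; rewrite /trunc in_nil eqxx.
  have i0 := in_l1_trunc [::] il.
  by rewrite chimul_id // (proj_id hcpt hT2 hK1 hK2 hE).
have -> : trunc (k :: s) l = seradd (serscale 1 (mono (l k) k)) (serscale 1 (trunc s l)).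
  apply: serP => n x; rewrite /trunc /mono /seradd /serscale !mul1r inE.
  have [->|_] /= := eqVneq n k; last by rewrite add0r.
  by rewrite (negbTE ks) addr0.
have ck := in_l1_ccont k il.
rewrite (proj_lin hE); [|exact: in_l1_mono|exact: in_l1_trunc].
by rewrite chimul_lin proj_mono // IH.
Qed.

(** Both sides agree on truncations; on the small hermitian remainder [r], a test state is small
    after [E] and after [chimul], each at most [2 (e/4)]. *)
Lemma proj_hermitian l : in_l1 l -> serstar l = l -> E l = chimul l.
Proof.
move=> il sl; apply: serP => k x; move: k; apply: test_state_sep => m c m0 cc.
have hs := is_state_test hne hcpt hT2 hK1 hK2 x m0 cc.
set phi := test_state x m c in hs *.
apply/eqP; rewrite -subr_eq0; apply/eqP; apply: cabs_small => e e0.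
have e40 : 0 < e / 4 by lra.
have [s [us ss ls]] := l1_tail il e40.
set r := sersub l (trunc s l) in ls.
have it := in_l1_trunc s il; have ir : in_l1 r by exact: in_l1B.
have lE : l = seradd (serscale 1 r) (serscale 1 (trunc s l)).
  by apply: serP => k y; rewrite /r /seradd /serscale !mul1r sersubE subrK.
have sr : serstar r = r by rewrite /r /sersub serstar_lin trunc_star // sl rmorph1 rmorphN1.
have [lin _ _] := posfun_state hcpt hT2 hK1 hK2 hs.
have dE a : in_l1 a -> dom sigma sigmai True (E a).
  move=> ia; split=> [|_]; first exact: (proj_l1 hE).
  exact: (proj_fixsupp hcpt hT2 hK1 hK2 hE).
have dC a : in_l1 a -> dom sigma sigmai True (chimul a).
  by move=> ia; split=> [|_]; [exact: in_l1_chimul|exact: fixsupp_chimul].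
rewrite {1}lE (proj_lin hE _ _ ir it) (proj_trunc us il) {2}lE chimul_lin.
rewrite (lin _ _ _ _ (dE _ ir) (dC _ it)) (lin _ _ _ _ (dC _ ir) (dC _ it)).
rewrite !mul1r opprD addrACA subrr addr0.
have h1 : cabs (phi (E r)) <= 2 * (e / 4).
  have dr : dom sigma sigmai False r by split.
  exact: (posfun_small hne hcpt hcs hcsi hK1 hK2
    (posfun_proj hne hcpt hT2 hK1 hK2 hE hp hs) dr sr e40 ls).
have h2 : cabs (phi (chimul r)) <= 2 * (e / 4).
  have scr : serstar (chimul r) = chimul r by rewrite -chimul_star sr.
  exact: (posfun_small hne hcpt hcs hcsi hK1 hK2 (posfun_state hcpt hT2 hK1 hK2 hs)
    (dC r ir) scr e40 (l1le_chimul ls)).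
by have := cabsB (phi (E r)) (phi (chimul r)); lra.
Qed.

Lemma proj_formula l : in_l1 l -> E l = chimul l.
Proof.
move=> il; have isl := in_l1_star hne hcpt hcs hcsi il.
have h2 : (2^-1 : R[i])^*%C = 2^-1 by rewrite fmorphV rmorph_nat.
have hi : ('i%C : R[i])^*%C = - 'i%C by simpc.
have ii : 'i%C * 'i%C = -1 :> R[i] by rewrite -expr2 sqr_i.
(* The hermitian decomposition [l = l1 - i l2]. *)
pose l1 := seradd (serscale 2^-1 l) (serscale 2^-1 (serstar l)).
pose l2 := seradd (serscale (2^-1 * 'i%C) l) (serscale (- (2^-1 * 'i%C)) (serstar l)).
have i1 : in_l1 l1 by exact: in_l1_lin.
have i2 : in_l1 l2 by exact: in_l1_lin.
have s1 : serstar l1 = l1.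
  rewrite /l1 serstar_lin (serstarK hK1 hK2) h2.
  by apply: serP => k x; rewrite /seradd addrC.
have s2 : serstar l2 = l2.
  have hc : (2^-1 * 'i%C : R[i])^*%C = - (2^-1 * 'i%C).
    by rewrite -mulrN -{2}h2 -hi; exact: rmorphM.
  have hcN : (- (2^-1 * 'i%C) : R[i])^*%C = 2^-1 * 'i%C.
    by rewrite -[RHS]opprK -[in RHS]hc; exact: rmorphN.
  rewrite /l2 serstar_lin (serstarK hK1 hK2) hc hcN.
  by apply: serP => k x; rewrite /seradd addrC.
have -> : l = seradd (serscale 1 l1) (serscale (- 'i%C) l2).
  apply: serP => k x; rewrite /l1 /l2 /seradd /serscale.
  set p := l k x; set q := serstar l k x.
  rewrite [RHS](_ : _ = 2^-1 * (p + q) - ('i%C * 'i%C) * 2^-1 * (p - q)); last by ring.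
  by rewrite ii; field.
by rewrite (proj_lin hE) // chimul_lin !proj_hermitian.
Qed.

End Formula.

Lemma in_l1_fin (s : seq int) l : (forall k, ccont (l k)) ->
  (forall k x, k \notin s -> l k x = 0) -> in_l1 l.
Proof.
move=> cl hl; have [p hp] := max_points hne hcpt cl.
have hs k : k \notin s -> l k (p k) = 0 by exact: hl.
apply: (@in_l1I _ _ hne hcpt _ (\sum_(k <- undup s) cabs (l k (p k)))) => // q.
by apply: sums_le_dom (sums_le_supp hs) => k; case: (hp k).
Qed.

(** * The image of a finite square as a sum of squares in the commutant *)

Section FiniteSquares.
Variables (s : seq int) (p : ser).
Hypotheses (us : uniq s) (cp : forall k, ccont (p k)).
Hypothesis ps : forall k x, k \notin s -> p k x = 0.

(* The number of [i] in [s] equivalent to [j] at [x]. *)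
Definition class_size j x : R := \sum_(i <- s) (`[< K (i - j) x >])%:R.

(** This is [chimul] of [delta^{-j} p], scaled by the root of the inverse class size; it keeps the
    coefficients [p_i] with [i] equivalent to [j] at [x]. *)
Definition square_part j : ser := fun n x =>
  (Num.sqrt (class_size j x)^-1)%:C * (chi n x * p (n + j) (iterz j x)).

Lemma class_size_ge0 j x : 0 <= class_size j x.
Proof. by apply: sumr_ge0 => i _; rewrite ler0n. Qed.

Lemma class_size_locally_constant j x : \forall y \near x, class_size j y = class_size j x.
Proof.
rewrite /class_size; elim: s => [|i t IH].
  by apply: nearW => y; rewrite !big_nil.
apply: filterS2 IH (interior_Fixk_locally_constant (i - j) x) => y h1 h2.
by rewrite !big_cons h1 h2.
Qed.

Lemma in_l1_square_part j : in_l1 (square_part j).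
Proof.
apply: (@in_l1_fin (map (fun k => k - j) s)) => [k|k x ks].
  apply: ccontM.
    apply: ccont_locally_constant => x.
    by apply: filterS (class_size_locally_constant j x) => y ->.
  apply: ccontM; first exact: ccont_chi.
  by apply: (ccont_comp (f := p (k + j))) => //; exact: continuous_iterz.
rewrite /square_part ps ?mulr0 //; apply: contra ks => ks.
by apply/mapP; exists (k + j); rewrite ?addrK.
Qed.

Lemma fixsupp_square_part j : fixsupp (square_part j).
Proof.
move=> n x; rewrite /square_part; have [/interior_subset //|h] := pselect (K n x).
by rewrite chi0 // mul0r mulr0 eqxx.
Qed.

(* Each equivalence class contributes its square once for each of its members, with
   weight the inverse of its size. *)
Lemma chimul_square n x : chimul (sermul (serstar p) p) n x =
  \sum_(j <- s) sermul (serstar (square_part j)) (square_part j) n x.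
Proof.
have ip : in_l1 p by exact: (@in_l1_fin s).
have isp := in_l1_star hne hcpt hcs hcsi ip.
have [M hM] := in_l1_bound hne hcpt ip; have [N hN] := in_l1_bound hne hcpt isp.
have hT := sermul_sums sigma sigmai hne n x hN hM.
set T := (fun k => serstar p k x * _) in hT.
pose G j i := T i * ((class_size j x)^-1%:C * chi (i + j) x * chi n x).
(* The index [i] stands for the coefficient [p_{-i}]. After shifting by [j], a term survives only
   when [-i] and [j] are equivalent; then [iterz j x = iterz (- i) x] identifies its factors with
   those of [T i]. *)
have GE j : sermul (serstar (square_part j)) (square_part j) n x = zsumC (G j).
  have hq := l1le_l1norm hne hcpt (in_l1_square_part j).
  rewrite (sermul_star_fixsupp hK1 hK2); last exact: fixsupp_square_part.
  have hU := star_sums hne 0 n x hq.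
  rewrite (_ : (fun k => _) = (fun k => (square_part j (0 - k) x)^*%C * square_part j (n - k) x));
    last by apply/funext => k; rewrite sub0r.
  rewrite -(zsumC_reindex (g := fun k => k + j) (h := fun k => k - j) (addrK j) (subrK j) hU).
  congr zsumC; apply/funext => i; rewrite /G sub0r /square_part.
  have [h|h] := pselect (K (i + j) x); last first.
    by rewrite chiN (chi0 h) !mul0r !mulr0 mul0r mulr0 conjc0 mul0r.
  have ex : iterz j x = iterz (- i) x.
    have hx : iterz (i + j) x = x by exact: (interior_subset h).
    by rewrite -[X in _ = iterz _ X]hx -(iterzD hK1 hK2) addKr.
  have e1 : - (i + j) + j = - i by ring.
  have e2 : n - (i + j) + j = n - i by ring.
  have e3 : chi (n - (i + j)) x = chi n x by rewrite -(chi_addl (n - (i + j)) h) addrC subrK.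
  rewrite chiN (chi1 h) e1 e2 e3 ex mul1r mulr1 /T /Defs.serstar.
  set v := (class_size j x)^-1.
  have vv : v%:C = (Num.sqrt v)%:C * (Num.sqrt v)%:C.
    by rewrite -rmorphM -expr2 sqr_sqrtr // invr_ge0 class_size_ge0.
  have -> : ((Num.sqrt v)%:C * p (- i) (iterz (- i) x))^*%C =
      (Num.sqrt v)%:C * (p (- i) (iterz (- i) x))^*%C.
    by rewrite -[X in _ = X * _]conjc_real; exact: rmorphM.
  by rewrite vv; ring.
under eq_bigr do rewrite GE.
have hG j : sums_le (G j) (N * M * cabs (class_size j x)^-1%:C).
  apply: sums_le_mulr => // [|i]; first exact: cabs_ge0.
  rewrite !cabsM; apply: le_trans (ler_piMr _ (cabs_chi n x)) _.
    by rewrite mulr_ge0 ?cabs_ge0.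
  exact: ler_piMr (cabs_ge0 _) (cabs_chi _ _).
rewrite -(zsumC_sum s hG).
rewrite /chimul -(zsumCZ _ hT); congr zsumC; apply/funext => i.
rewrite -mulr_sumr mulrC.
have [his|his] := boolP (- i \in s); last first.
  rewrite (_ : T i = 0) ?mul0r //.
  by rewrite /T /Defs.serstar ps // conjc0 mul0r.
(* [D] is the size of the class of [-i], positive because [-i] is itself in [s]. It equals
   [class_size j x] for each member [j], so the weights add up to 1. *)
congr (_ * _); pose D : R := \sum_(j <- s) (`[< K (i + j) x >])%:R.
have D0 : D != 0.
  apply: lt0r_neq0; rewrite /D (bigD1_seq (- i)) //= subrr.
  rewrite asboolT; last exact: interior_Fixk0.
  by rewrite ltr_pwDl // sumr_ge0 // => j _; rewrite ler0n.
have DE : D%:C = \sum_(j <- s) chi (i + j) x.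
  by rewrite rmorph_sum; apply: eq_bigr => j _; rewrite rmorph_nat.
rewrite (eq_bigr (fun j => (D^-1)%:C * chi n x * chi (i + j) x)); last first.
  move=> j _; have [h|h] := pselect (K (i + j) x); last by rewrite (chi0 h) !mulr0 mul0r.
  suff -> : class_size j x = D by rewrite mulrAC.
  apply: eq_bigr => k _; congr (nat_of_bool _)%:R; apply: asbool_equiv_eq.
  have -> : i + k = (i + j) + (k - j) by ring.
  split; first exact: interior_FixkD.
  by move=> /(interior_FixkD hK1 hK2 (interior_FixkN hK1 hK2 h)); rewrite addKr.
by rewrite -mulr_sumr -DE mulrAC -rmorphM /= mulVf // mul1r.
Qed.

End FiniteSquares.

(** * Positivity on the whole cone *)

Lemma seraddE a b : seradd a b = seradd (serscale 1 a) (serscale 1 b).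
Proof. by apply: serP => k x; rewrite /seradd /serscale !mul1r. Qed.

Lemma posfunD P psi a b : posfun sigma sigmai P psi -> dom sigma sigmai P a ->
  dom sigma sigmai P b -> psi (seradd a b) = psi a + psi b.
Proof. by move=> [lin _ _] da db; rewrite seraddE lin // !mul1r. Qed.

Lemma domD P a b : dom sigma sigmai P a -> dom sigma sigmai P b ->
  dom sigma sigmai P (seradd a b).
Proof.
move=> [ia fa] [ib fb]; rewrite seraddE; split; first exact: in_l1_lin.
by move=> p; apply: fixsupp_lin; [exact: fa|exact: fb].
Qed.

Lemma dom_square P a : dom sigma sigmai P a -> dom sigma sigmai P (sermul (serstar a) a).
Proof.
move=> [ia fa]; split=> [|p]; first by apply: in_l1M => //; exact: in_l1_star.
by have fa' := fa p; apply: fixsuppM => //; exact: fixsupp_star.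
Qed.

Lemma dom_ser0 P : dom sigma sigmai P (@ser0 R X).
Proof.
split=> [|_ k x]; last by rewrite /ser0 eqxx.
by apply: (@in_l1_fin [::]) => // k; exact: ccont_cst.
Qed.

Lemma posfun_ser0 P psi : posfun sigma sigmai P psi -> psi (@ser0 R X) = 0.
Proof.
move=> hpsi; have := posfunD hpsi (dom_ser0 P) (dom_ser0 P).
have -> : seradd (@ser0 R X) (@ser0 R X) = @ser0 R X.
  by apply: serP => k x; rewrite /seradd /ser0 addr0.
by move/eqP; rewrite -subr_eq0 opprD addrA subrr sub0r oppr_eq0 => /eqP.
Qed.

Lemma in_l1_foldr (s : seq ser) : (forall a, a \in s -> in_l1 a) ->
  in_l1 (foldr (fun a acc => seradd (sermul (serstar a) a) acc) (@ser0 R X) s).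
Proof.
elim: s => [_|a s IH hs] /=; first by case: (dom_ser0 False).
apply: in_l1D => //; last by apply: IH => b bs; apply: hs; rewrite inE bs orbT.
have ia : in_l1 a by apply: hs; exact: mem_head.
by apply: in_l1M => //; exact: in_l1_star.
Qed.

Lemma in_l1_poscone l : poscone sigma sigmai l -> in_l1 l.
Proof. by move=> [s [hs ->]]; exact: in_l1_foldr. Qed.

Lemma dom_chimul P l : in_l1 l -> dom sigma sigmai P (chimul l).
Proof. by move=> il; split=> [|_]; [exact: in_l1_chimul|exact: fixsupp_chimul]. Qed.

Lemma state_chimul_trunc phi s a : is_state sigma sigmai phi -> uniq s -> in_l1 a ->
  0 <= phi (chimul (sermul (serstar (trunc s a)) (trunc s a))).
Proof.
move=> hphi us ia; have hpsi := posfun_state hcpt hT2 hK1 hK2 hphi.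
have ct k : ccont (trunc s a k) by apply: in_l1_ccont; exact: in_l1_trunc.
have st k x : k \notin s -> trunc s a k x = 0 by rewrite /trunc => /negbTE ->.
pose q := square_part s (trunc s a).
have -> : chimul (sermul (serstar (trunc s a)) (trunc s a)) =
    foldr (fun j acc => seradd (sermul (serstar (q j)) (q j)) acc) (@ser0 R X) s.
  apply: serP => n x; rewrite (chimul_square us ct st) -/q.
  by elim: s {us ct st} q => [|j t IH] q; rewrite ?big_nil // big_cons IH.
have dq j : dom sigma sigmai True (q j).
  by split=> [|_]; [exact: in_l1_square_part|exact: fixsupp_square_part].
have [_ pos _] := hpsi.
move: q dq => q dq; rewrite {us ct st ia}.
suff [//] : 0 <= phi (foldr (fun j acc => seradd (sermul (serstar (q j)) (q j)) acc)
    (@ser0 R X) s) /\ dom sigma sigmai True (foldr (fun j acc =>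
    seradd (sermul (serstar (q j)) (q j)) acc) (@ser0 R X) s).
elim: s => [|j t [IH1 IH2]] /=.
  by rewrite (posfun_ser0 hpsi); split=> //; exact: dom_ser0.
have dj := dom_square (dq j).
split; last exact: domD.
by rewrite (posfunD hpsi) // addr_ge0 // pos.
Qed.

(** For a truncation [p] of [a], the difference [a^* a - p^* p] is hermitian and small, so
    [posfun_small] controls the error made by the state. *)
Lemma state_chimul_square phi a : is_state sigma sigmai phi -> in_l1 a ->
  0 <= phi (chimul (sermul (serstar a) a)).
Proof.
move=> hphi ia; have hpsi := posfun_state hcpt hT2 hK1 hK2 hphi.
apply: complex_ge0_closed => e e0.
have [M hM] := in_l1_bound hne hcpt ia; have M0 := l1le_ge0 hne hM.
(* The two squares then differ by at most [2 M] times this, hence by at most [e / 2], and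
   [posfun_small] doubles the bound. *)
have d0 : 0 < e / (4 * (M + 1)) by rewrite divr_gt0 //; lra.
have [s [us _ ls]] := l1_tail ia d0; set p := trunc s a in ls.
have ip : in_l1 p by exact: in_l1_trunc.
exists (phi (chimul (sermul (serstar p) p))); first exact: state_chimul_trunc.
have isa := in_l1_star hne hcpt hcs hcsi ia.
have isp := in_l1_star hne hcpt hcs hcsi ip.
have iaa := in_l1M hne hcpt hcs hcsi isa ia.
have ipp := in_l1M hne hcpt hcs hcsi isp ip.
pose r := sersub (sermul (serstar a) a) (sermul (serstar p) p).
have sr : serstar r = r.
  by rewrite /r /sersub serstar_lin !(serstar_mul hne hcpt hK1 hK2) //
    !(serstarK hK1 hK2) rmorph1 rmorphN1.
have ir : in_l1 r by exact: in_l1B.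
have lr : l1le r (e / 2).
  have lss : l1le (sersub (serstar a) (serstar p)) (e / (4 * (M + 1))).
    have -> : sersub (serstar a) (serstar p) = serstar (sersub a p).
      by rewrite /sersub serstar_lin rmorph1 rmorphN1.
    exact: l1le_star.
  have := l1le_mul_sub sigma sigmai hne hcpt isa ia isp ip (l1le_star sigma sigmai hM)
    (l1le_trunc s hM) lss ls.
  apply: l1le_weak; rewrite !mulrA [_ * M]mulrC !mulrA -mulrDl ler_pdivrMr; last by lra.
  have : 0 <= M * e by rewrite mulr_ge0 // ltW.
  lra.
have -> : phi (chimul (sermul (serstar a) a)) - phi (chimul (sermul (serstar p) p)) =
    phi (chimul r).
  have [lin _ _] := hpsi.
  by rewrite chimul_sub (lin _ _ _ _ (dom_chimul True iaa) (dom_chimul True ipp)) mul1r mulN1r.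
have e20 : 0 < e / 2 by lra.
have := posfun_small hne hcpt hcs hcsi hK1 hK2 hpsi (dom_chimul True ir) _ e20 (l1le_chimul lr).
by rewrite -chimul_star sr => /(_ erefl); lra.
Qed.

Lemma is_positive_chimul : is_positive sigma sigmai chimul.
Proof.
move=> _ phi [s [hs ->]] hphi; have hpsi := posfun_state hcpt hT2 hK1 hK2 hphi.
elim: s hs => [_|a s IH hs] /=.
  rewrite (_ : chimul _ = @ser0 R X) ?(posfun_ser0 hpsi) //.
  by apply: serP => k x; rewrite /chimul /ser0 mulr0.
have ia : in_l1 a by apply: hs; exact: mem_head.
have hs' b : b \in s -> in_l1 b by move=> bs; apply: hs; rewrite inE bs orbT.
have isq : in_l1 (sermul (serstar a) a) by apply: in_l1M => //; exact: in_l1_star.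
have ifo := in_l1_foldr hs'.
set acc := foldr _ _ _ in ifo *.
have -> : chimul (seradd (sermul (serstar a) a) acc) =
    seradd (chimul (sermul (serstar a) a)) (chimul acc).
  by apply: serP => k x; rewrite /chimul /seradd mulrDr.
rewrite (posfunD hpsi); [|exact: dom_chimul|exact: dom_chimul].
by rewrite addr_ge0 ?IH //; exact: state_chimul_square.
Qed.

(** * Faithfulness through the coefficient at 0 *)

Lemma square0E a x : sermul (serstar a) a 0 x =
  zsumC (fun k => (cabs (a (- k) (iterz (- k) x)) ^+ 2)%:C).
Proof.
by congr zsumC; apply/funext => k; rewrite /Defs.serstar sub0r mulrC conjcE.
Qed.

Lemma square0_sums a x : in_l1 a ->
  exists M, sums_le (fun k => (cabs (a (- k) (iterz (- k) x)) ^+ 2)%:C) M.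
Proof.
move=> ia; have isa := in_l1_star hne hcpt hcs hcsi ia.
exists (l1norm (serstar a) * l1norm a).
have := sermul_sums sigma sigmai hne 0 x (l1le_l1norm hne hcpt isa) (l1le_l1norm hne hcpt ia).
by apply: sums_le_dom => k; rewrite /Defs.serstar sub0r mulrC conjcE.
Qed.

Lemma square0_ge0 a x : in_l1 a -> 0 <= sermul (serstar a) a 0 x.
Proof.
move=> /(square0_sums x)[M hM]; rewrite square0E; apply: zsumC_ge0 hM _ => k.
by rewrite lecR sqr_ge0.
Qed.

Lemma square0_eq0 a : in_l1 a -> (forall x, sermul (serstar a) a 0 x = 0) -> a = @ser0 R X.
Proof.
move=> ia h; apply: serP => k x.
(* Evaluating at [sigma^{-k} x] makes the term of index [-k] equal to [|a_k(x)|^2]. *)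
have [M hM] := square0_sums (iterz (- k) x) ia.
have := h (iterz (- k) x); rewrite square0E => hz.
have ge0 j : 0 <= (cabs (a (- j) (iterz (- j) (iterz (- k) x))) ^+ 2)%:C.
  by rewrite lecR sqr_ge0.
have := zsumC_ge0_eq0 hM ge0 hz (- k); rewrite opprK (iterzK hK1 hK2) => -[/eqP].
by rewrite expf_eq0 /= => /eqP/cabs_eq0.
Qed.

(** As [chi_0 = 1], the coefficient at 0 survives; for a sum of squares it is a sum of nonnegative
    functions, so each one vanishes and with it each [a]. *)
Lemma faithful_chimul l : poscone sigma sigmai l -> chimul l = @ser0 R X -> l = @ser0 R X.
Proof.
move=> [s [hs ->]] hl.
have {hl} : forall x, foldr (fun a acc => seradd (sermul (serstar a) a) acc)
    (@ser0 R X) s 0 x = 0.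
  move=> x; have := congr1 (fun l : ser => l 0 x) hl; rewrite /chimul chi1 ?mul1r //.
  exact: interior_Fixk0.
elim: s hs => // a s IH hs h0 /=.
have ia : in_l1 a by apply: hs; exact: mem_head.
have hs' b : b \in s -> in_l1 b by move=> bs; apply: hs; rewrite inE bs orbT.
have ge0 x : 0 <= foldr (fun a acc => seradd (sermul (serstar a) a) acc) (@ser0 R X) s 0 x.
  elim: s hs' {IH hs h0} => //= b t IH ht.
  rewrite addr_ge0 ?IH //; last by move=> d dt; apply: ht; rewrite inE dt orbT.
  by apply: square0_ge0; apply: ht; exact: mem_head.
have both x : (sermul (serstar a) a 0 x == 0) &&
    (foldr (fun a acc => seradd (sermul (serstar a) a) acc) (@ser0 R X) s 0 x == 0).
  by rewrite -paddr_eq0 ?square0_ge0 //; apply/eqP; exact: h0.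
rewrite IH //; last by move=> x; have /andP[_ /eqP] := both x.
rewrite (square0_eq0 ia); last by move=> x; have /andP[/eqP] := both x.
apply: serP => n x; rewrite /seradd /ser0 addr0; apply: zsumC0 => k.
by rewrite mulr0.
Qed.

(** * Bimodule property, norm and finite sums *)

Lemma chimul_mull a l : in_l1 a -> fixsupp a -> in_l1 l ->
  chimul (sermul a l) = sermul a (chimul l).
Proof.
move=> ia fa il; have hs n x := sermul_sums sigma sigmai hne n x
  (l1le_l1norm hne hcpt ia) (l1le_l1norm hne hcpt il).
apply: serP => n x; rewrite /chimul -(zsumCZ _ (hs n x)); congr zsumC; apply/funext => k.
have [->|h] := eqVneq (a k x) 0; first by rewrite !mul0r mulr0.
have kx := fixsupp_interior (in_l1_ccont k ia) fa h.
(* A nonzero [a k x] puts [k] in the subgroup attached to [x], which does not change along the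
   orbit. *)
have e : chi n x = chi (n - k) x by rewrite -(chi_addl (n - k) kx) addrC subrK.
by rewrite chi_iterz e; ring.
Qed.

Lemma chimul_mulr b l : in_l1 b -> fixsupp b -> in_l1 l ->
  chimul (sermul l b) = sermul (chimul l) b.
Proof.
move=> ib fb il; have hs n x := sermul_sums sigma sigmai hne n x
  (l1le_l1norm hne hcpt il) (l1le_l1norm hne hcpt ib).
apply: serP => n x; rewrite /chimul -(zsumCZ _ (hs n x)); congr zsumC; apply/funext => k.
have [->|h] := eqVneq (b (n - k) (iterz (- k) x)) 0; first by rewrite !mulr0.
have kx := fixsupp_interior (in_l1_ccont (n - k) ib) fb h.
have e : chi n x = chi k x.
  by rewrite -(chi_iterz (- k) n x) -(chi_iterz (- k) k x) -(chi_addl k kx) subrK.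
by rewrite e; ring.
Qed.

Lemma l1norm_ser1 : l1norm (@ser1 R X) = 1.
Proof.
have i1 := in_l1_ser1 R hne hcpt.
apply/eqP; rewrite eq_le; apply/andP; split.
  apply: l1norm_le => //; apply: l1le_emb => // x; by rewrite cabs1.
case: hne => x _; have := l1le_cabs 0 x (l1le_l1norm hne hcpt i1).
by rewrite /ser1 /emb eqxx cabs1.
Qed.

(** The bound 1 is attained at the unit. Only agreement with [chimul] on [l^1] is asked, since a
    projection is determined only there. *)
Lemma norm_one_chimul (E : ser -> ser) : (forall l, in_l1 l -> E l = chimul l) ->
  is_norm_one E.
Proof.
move=> hE; have i1 := in_l1_ser1 R hne hcpt.
have ub : ubound (opnorm_set E) 1.
  move=> _ [l [il ll] <-]; rewrite hE //; apply: le_trans ll.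
  exact: (l1norm_le hne hcpt (in_l1_chimul il) (l1le_chimul (l1le_l1norm hne hcpt il))).
have mem1 : opnorm_set E 1.
  exists (@ser1 R X); first by split; rewrite ?l1norm_ser1.
  rewrite hE // chimul_id // ?l1norm_ser1 //; exact: fixsupp1.
have hsup : has_sup (opnorm_set E) by split; [exists 1|exists 1].
split=> //; apply/eqP; rewrite eq_le; apply/andP; split.
  by apply: ge_sup => //; exists 1.
by apply: ub_le_sup => //; exists 1.
Qed.

Lemma in_c00_chimul l : in_c00 l -> in_c00 (chimul l).
Proof.
move=> [il [N hN]]; split; first exact: in_l1_chimul.
exists N => k kN; apply/funext => x; rewrite /chimul hN //; exact: mulr0.
Qed.

End CanonicalProjection.

(** * Equivalence, uniqueness and properties of the projection *)

Theorem theorem5p7 (R : realType) (X : topologicalType)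
  (sigma sigmai : X -> X)
  (hne : [set: X] !=set0) (hcpt : compact [set: X]) (hT2 : hausdorff_space X)
  (hcs : continuous sigma) (hcsi : continuous sigmai)
  (hK1 : cancel sigma sigmai) (hK2 : cancel sigmai sigma) :
  ((forall k : int, closed (interior (Fixk sigma sigmai k))) <->
   (exists E : ser R X -> ser R X,
      is_proj sigma sigmai E /\ is_positive sigma sigmai E)) /\
  ((forall k : int, closed (interior (Fixk sigma sigmai k))) ->
   (forall E1 E2 : ser R X -> ser R X,
      is_proj sigma sigmai E1 -> is_positive sigma sigmai E1 ->
      is_proj sigma sigmai E2 -> is_positive sigma sigmai E2 ->
      forall l, in_l1 l -> E1 l = E2 l) /\
   (forall k : int, ccont (chi R sigma sigmai k)) /\
   (forall E : ser R X -> ser R X,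
      is_proj sigma sigmai E -> is_positive sigma sigmai E ->
      (forall l, in_l1 l -> E l = (fun k x => chi R sigma sigmai k x * l k x)) /\
      is_faithful sigma sigmai E /\
      is_involutive sigma sigmai E /\
      is_norm_one E /\
      is_bimodule_morphism sigma sigmai E /\
      restricts_c00 sigma sigmai E)).
Proof.
have conv (E : ser R X -> ser R X) : is_proj sigma sigmai E ->
    is_positive sigma sigmai E -> forall k : int, closed (interior (Fixk sigma sigmai k)).
  by move=> hE hp k; apply: proj_interior_closed hE hp k.
split.
  split=> [hcl|[E [hE hp]]]; last exact: conv hE hp.
  exists (chimul sigma sigmai); split; first exact: is_proj_chimul.
  exact: is_positive_chimul.
move=> hcl.
(* Uniqueness and all remaining properties are read off from [chimul] through this formula. *)
have formula (E : ser R X -> ser R X) : is_proj sigma sigmai E ->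
    is_positive sigma sigmai E -> forall l, in_l1 l -> E l = chimul sigma sigmai l.
  by move=> hE hp l il; apply: proj_formula.
split; first by move=> E1 E2 h1 p1 h2 p2 l il; rewrite (formula E1) // (formula E2).
split; first by move=> k; exact: ccont_chi.
move=> E hE hp; have fE := formula E hE hp.
split=> //; split; [|split; [|split; [|split]]].
- move=> l pl; rewrite fE; first exact: faithful_chimul.
  exact: in_l1_poscone pl.
- move=> l il; rewrite !fE //; first exact: chimul_star.
  exact: in_l1_star.
- exact: norm_one_chimul fE.
- move=> a l b /(comm1P hcpt hT2 hK1 hK2)[ia fa] il /(comm1P hcpt hT2 hK1 hK2)[ib fb].
  have ial := in_l1M hne hcpt hcs hcsi ia il; have ilb := in_l1M hne hcpt hcs hcsi il ib.
  rewrite (fE _ ial) (fE _ ilb) (fE _ il).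
  by split; [exact: chimul_mull|exact: chimul_mulr].
- split=> [l cl|l /(comm00P hcpt hT2 hK1 hK2)[cl fl]].
    have [il _] := cl; rewrite fE //; apply/(comm00P hcpt hT2 hK1 hK2).
    by split; [exact: in_c00_chimul|exact: fixsupp_chimul].
  by exists l; split=> //; have [il _] := cl; rewrite fE // chimul_id.
Qed.
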